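(* Let $p\ge 1$ be a fixed constant. Temporal Resolving Set, restricted to temporal graphs $(S,\lambda)$ where $S$ is a subdivided star and $\lambda$ is a $p$-periodic 1-labeling, is solvable in polynomial time.
   Context: A subdivided star is a tree obtained from a star by subdividing its edges, each an arbitrary number (possibly zero) of times. A $p$-periodic 1-labeling $\lambda$ of a finite simple undirected graph $G=(V,E)$ assigns to each edge $e$ an infinite set of time-steps of the form $\{i,i+p,i+2p,\dots\}$ with $i\in\{1,\dots,p\}$ (so each edge is present exactly once in every $p$ consecutive time-steps; the labeling is given as input by the values $i$). In the temporal graph $\mathcal{G}=(G,\lambda)$, a journey from $u$ to $v$ is a path in $G$ from $u$ to $v$ together with a choice, for each edge of the path, of a time-step in its label set so that the chosen time-steps are strictly increasing along the path. The temporal distance $\mathrm{dist}_t(u,v)$ is the smallest time-step at which a journey from $u$ reaches $v$ (with $\mathrm{dist}_t(u,u)=0$, and $\infty$ if there is no journey). A set $R\subseteq V$ is a temporal resolving set if (i) for every $v\in V$ there is a journey from some $s\in R$ to $v$ (every vertex is reached from itself), and (ii) for every two distinct $u,v\in V$ there is $s\in R$ with $\mathrm{dist}_t(s,u)\neq\mathrm{dist}_t(s,v)$. Temporal Resolving Set is the problem: given a temporal graph $\mathcal{G}$ and an integer $k$, decide whether $\mathcal{G}$ has a temporal resolving set of size at most $k$. *)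

(* Defs.v *)
From Corelib Require Import PosDef.
From mathcomp Require Import all_boot all_order all_algebra.
From mathcomp Require Import boolp.

Set Implicit Arguments.
Unset Strict Implicit.
Unset Printing Implicit Defensive.

(* * Temporal graphs *)

Record sgraph (V : finType) := SGraph {
  adj :> rel V;
  adj_sym : symmetric adj;
  adj_irr : irreflexive adj }.

(* [times u v] is the label set of the edge {u, v}; its values on pairs that
   are not edges are irrelevant.  Time-steps are positive integers. *)
Record tgraph (V : finType) := TGraph {
  graph :> sgraph V;
  times : V -> V -> pred nat;
  times_sym : forall u v, times u v =1 times v u }.

Section Distance.
Variables (V : finType) (G : tgraph V).

Definition hop (x y : V * nat) : bool :=
  [&& adj G x.1 y.1, x.2 < y.2 & times G x.1 y.1 y.2].

(* A journey is the list of the pairs (vertex entered, time-step used to enter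
   it).  It starts from (u, 0), which makes the first time-step positive and
   gives arrival time 0 to the empty journey from u to u. *)
Definition journey (u : V) (js : seq (V * nat)) : bool :=
  path hop (u, 0) js && uniq (u :: map fst js).

Definition arrives (u v : V) (t : nat) : Prop :=
  exists2 js, journey u js & last (u, 0) js = (v, t).

(* [None] stands for infinity. *)
Definition tdist (u v : V) : option nat :=
  match pselect (exists t, `[< arrives u v t >]) with
  | left ex_t => Some (ex_minn ex_t)
  | right _ => None
  end.

Definition temporal_resolving (R : {set V}) : Prop :=
  (forall v, exists2 s, s \in R & exists t, arrives s v t) /\
  (forall u v, u != v -> exists2 s, s \in R & tdist s u <> tdist s v).

Definition has_temporal_resolving_set (k : int) : Prop :=
  exists2 R : {set V}, temporal_resolving R & (#|R|%:Z <= k)%R.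

End Distance.

(* * Periodic 1-labelings *)

Record periodic_tgraph (p : nat) := PeriodicTGraph {
  nvertices : nat;
  pgraph : sgraph 'I_nvertices;
  label : 'I_nvertices -> 'I_nvertices -> nat;
  label_sym : forall u v, label u v = label v u;
  label_range : forall u v, pgraph u v -> 1 <= label u v <= p }.

Arguments label {p} _ _ _.

(* {i, i + p, i + 2p, ...} *)
Definition progression (p i : nat) : pred nat :=
  fun t => (i <= t) && (t == i %[mod p]).

Lemma progression_label_sym p (G : periodic_tgraph p) u v :
  progression p (label G u v) =1 progression p (label G v u).
Proof. by rewrite label_sym. Qed.

Definition tgraph_of p (G : periodic_tgraph p) : tgraph 'I_(nvertices G) :=
  TGraph (pgraph G) (progression_label_sym (G := G)).

(* * Subdivided stars *)

(* The star with m edges, the i-th edge being subdivided l i times: [None] is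
   the centre, and the i-th leg consists of the vertices (i, 0), ..., (i, l i),
   from the centre outwards. *)
Definition sstar_vertex m (l : 'I_m -> nat) : finType :=
  option {i : 'I_m & 'I_(l i).+1}.

Definition sstar_arc m (l : 'I_m -> nat) : rel (sstar_vertex l) :=
  fun x y => match x, y with
  | None, Some b => tagged b == 0 :> nat
  | Some a, Some b => (tag a == tag b) && (tagged b == (tagged a).+1 :> nat)
  | _, None => false
  end.

Definition sstar_adj m (l : 'I_m -> nat) : rel (sstar_vertex l) :=
  fun x y => sstar_arc x y || sstar_arc y x.

Definition subdivided_star (V : finType) (G : sgraph V) : Prop :=
  exists (m : nat) (l : 'I_m -> nat) (f : V -> sstar_vertex l),
    bijective f /\ forall u v, adj G u v = sstar_adj (f u) (f v).

(* * Polynomial time *)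

(* The model of computation is the WHILE language of N. D. Jones ("Computability
   and Complexity from a Programming Perspective", MIT Press, 1997): imperative
   programs over binary trees, where every elementary operation costs one unit.
   Trees are represented with sharing, and the only test is whether a tree is a
   leaf, so each operation is indeed constant time on a pointer machine.  The
   problems decidable in polynomial time in this model are exactly those
   decidable in polynomial time by Turing machines. *)

Inductive tree := Leaf | Node of tree & tree.

Fixpoint tree_size (x : tree) : nat :=
  if x is Node l r then (tree_size l + tree_size r).+1 else 1.

Definition is_node (x : tree) : bool := if x is Node _ _ then true else false.
Definition hd (x : tree) : tree := if x is Node l _ then l else Leaf.
Definition tl (x : tree) : tree := if x is Node _ r then r else Leaf.

Inductive expr :=
  | Var of nat
  | Nil
  | Cons of expr & expr
  | Hd of expr
  | Tl of expr.

Inductive cmd :=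
  | Assign of nat & expr
  | Seq of cmd & cmd
  | If of expr & cmd & cmd
  | While of expr & cmd.

Definition store := nat -> tree.

Definition update (s : store) (x : nat) (a : tree) : store :=
  fun y => if y == x then a else s y.

Fixpoint eval (s : store) (e : expr) : tree :=
  match e with
  | Var x => s x
  | Nil => Leaf
  | Cons e1 e2 => Node (eval s e1) (eval s e2)
  | Hd e1 => hd (eval s e1)
  | Tl e1 => tl (eval s e1)
  end.

Fixpoint cost (e : expr) : nat :=
  match e with
  | Var _ | Nil => 1
  | Cons e1 e2 => (cost e1 + cost e2).+1
  | Hd e1 | Tl e1 => (cost e1).+1
  end.

(* [exec c s s' t]: started in store s, c halts in store s' after time t. *)
Inductive exec : cmd -> store -> store -> nat -> Prop :=
  | ExecAssign x e s :
      exec (Assign x e) s (update s x (eval s e)) (cost e).+1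
  | ExecSeq c1 c2 s s1 s2 t1 t2 :
      exec c1 s s1 t1 -> exec c2 s1 s2 t2 ->
      exec (Seq c1 c2) s s2 (t1 + t2).+1
  | ExecIf e c1 c2 s s' t :
      exec (if is_node (eval s e) then c1 else c2) s s' t ->
      exec (If e c1 c2) s s' (cost e + t).+1
  | ExecWhileStop e c s :
      ~~ is_node (eval s e) -> exec (While e c) s s (cost e).+1
  | ExecWhileLoop e c s s1 s2 t1 t2 :
      is_node (eval s e) -> exec c s s1 t1 -> exec (While e c) s1 s2 t2 ->
      exec (While e c) s s2 (cost e + t1 + t2).+1.

(* Variable 0 holds the input and, at the end, the output. *)
Definition run (c : cmd) (input output : tree) (t : nat) : Prop :=
  exists2 s : store,
    exec c (fun x => if x == 0 then input else Leaf) s t & s 0 = output.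

(* The decision problem [Q], restricted to the instances in [C], is solvable in
   polynomial time; an instance is accepted when the output is not a leaf. *)
Definition polynomial_time (I : Type) (enc : I -> tree) (C Q : I -> Prop) :=
  exists (c : cmd) (q : {poly nat}), forall x : I, C x ->
    exists (output : tree) (t : nat),
      [/\ run c (enc x) output t,
          t <= (q.[tree_size (enc x)])%R
        & is_node output <-> Q x].

(* * Encoding of the instances *)

Definition enc_seq (A : Type) (enc : A -> tree) (s : seq A) : tree :=
  foldr (fun a x => Node (enc a) x) Leaf s.

Definition enc_bool (b : bool) : tree := if b then Node Leaf Leaf else Leaf.

Fixpoint pos_bits (n : positive) : seq bool :=
  match n with
  | xH => [:: true]
  | xO n' => false :: pos_bits n'
  | xI n' => true :: pos_bits n'
  end.

(* Binary, least significant bit first; 0 is the empty list. *)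
Definition enc_nat (n : nat) : tree :=
  enc_seq enc_bool (if bin_of_nat n is Npos n' then pos_bits n' else [::]).

Definition enc_int (k : int) : tree :=
  Node (enc_bool (k < 0)%R) (enc_nat `|k|%N).

(* Adjacency matrix, row by row; an edge is given by its label and a non-edge
   by 0, which is not a label. *)
Definition enc_tgraph p (G : periodic_tgraph p) : tree :=
  enc_seq (fun u => enc_seq (fun v => enc_nat (if pgraph G u v then label G u v else 0))
                            (enum 'I_(nvertices G)))
          (enum 'I_(nvertices G)).

Definition instance p : Type := (periodic_tgraph p * int)%type.

Definition enc_instance p (x : instance p) : tree :=
  Node (enc_tgraph x.1) (enc_int x.2).

Definition temporal_resolving_set p (x : instance p) : Prop :=
  has_temporal_resolving_set (tgraph_of x.1) x.2.

(* Main.v *)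
(* A journey from a vertex of a leg enters the centre at a time-step congruent modulo
   p to the label of the first edge of that leg. Hence all vertices of a leg
   separate the same pairs outside it, while its leaf moreover separates every pair
   that meets the leg: in a resolving set each vertex other than the centre can be
   replaced by the leaf of its leg. Two legs without a vertex of the resolving set
   have distinct first labels, so there are at most p of them. An optimal resolving
   set is therefore obtained from the set of vertices of degree at most one by
   removing boundedly many vertices and adding one. There are polynomially many
   such sets, and each is tested by simulating the spread from every source for
   p n time-steps; the centre is never computed.

   Programs are obtained from functions on encodable types through closure
   properties of the class of functions computable in polynomial time. *)
Require Import Defs.
From mathcomp Require Import all_boot all_order all_algebra.
From mathcomp Require Import zify.
From Corelib Require Import PosDef.

Set Implicit Arguments.
Unset Strict Implicit.
Unset Printing Implicit Defensive.
Import GRing.Theory.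

(** * Functions computable in polynomial time *)

Local Notation peval q n := (@horner nat q n).

(** The coefficients are natural numbers, so every monomial is monotone. This allows a size bound to
    be substituted into a cost bound. *)
Lemma horner_le (q : {poly nat}) m n : m <= n -> peval q m <= peval q n.
Proof.
move=> le_mn; rewrite !horner_coef.
rewrite !(big_morph id natrDE natr0E).
apply: leq_sum => i _.
rewrite !natrXE leq_mul //.
by case: (val i) => // e; rewrite leq_exp2r.
Qed.

Definition poly_bounded (b : nat -> nat) : Prop :=
  exists q : {poly nat}, forall n, b n <= peval q n.

Lemma poly_bounded_const k : poly_bounded (fun=> k).
Proof. by exists (k%:P)%R => n; rewrite hornerC. Qed.

Lemma poly_bounded_id : poly_bounded id.
Proof. by exists 'X%R => n; rewrite hornerX. Qed.

Lemma poly_boundedD b b' :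
  poly_bounded b -> poly_bounded b' -> poly_bounded (fun n => b n + b' n).
Proof.
move=> [q bq] [q' bq']; exists (q + q')%R => n.
by rewrite hornerD leq_add.
Qed.

Lemma poly_boundedM b b' :
  poly_bounded b -> poly_bounded b' -> poly_bounded (fun n => b n * b' n).
Proof.
move=> [q bq] [q' bq']; exists (q * q')%R => n.
by rewrite hornerM leq_mul.
Qed.

Lemma poly_bounded_horner (q : {poly nat}) b :
  poly_bounded b -> poly_bounded (fun n => peval q (b n)).
Proof.
move=> [q' bq']; exists (q \Po q')%R => n.
by rewrite horner_comp horner_le.
Qed.

Lemma poly_boundedS b : poly_bounded b -> poly_bounded (fun n => (b n).+1).
Proof.
move=> pb; have [q bq] := poly_boundedD pb (poly_bounded_const 1).
by exists q => n; rewrite -addn1.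
Qed.

Ltac poly_bounded_tac :=
  repeat first
    [ apply: poly_bounded_const | apply: poly_bounded_id
    | apply: poly_boundedS | apply: poly_boundedD | apply: poly_boundedM
    | apply: poly_bounded_horner ].

(** * Encodable types and the class of polynomial-time functions *)

(** Canonical instances let unification find the encoding from the type, so that [ptime] can be
    stated for plain functions. *)
Structure encodable := Encodable { carrier :> Type; encode : carrier -> tree }.

Canonical encodable_bool := Encodable enc_bool.
Canonical encodable_seq (A : encodable) := Encodable (enc_seq (@encode A)).
Canonical encodable_prod (A B : encodable) :=
  Encodable (fun x : A * B => Node (encode x.1) (encode x.2)).

Definition esize (A : encodable) (a : A) : nat := tree_size (encode a).

Lemma tree_size_gt0 x : 0 < tree_size x. Proof. by case: x. Qed.

Lemma esize_gt0 (A : encodable) (a : A) : 0 < esize a.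
Proof. exact: tree_size_gt0. Qed.

Lemma esize_pair (A B : encodable) (a : A) (b : B) :
  esize (a, b) = (esize a + esize b).+1.
Proof. by []. Qed.

Lemma esize_cons (A : encodable) (a : A) (s : seq A) :
  esize (a :: s) = (esize a + esize s).+1.
Proof. by []. Qed.

Lemma esize_bool (b : bool) : esize b <= 3. Proof. by case: b. Qed.

Lemma esize_seq (A : encodable) (s : seq A) k :
  (forall a, List.In a s -> esize a <= k) -> esize s <= size s * k.+1 + 1.
Proof.
elim: s => // a s IHs le_k; rewrite esize_cons /=.
have := le_k a (or_introl erefl).
have := IHs (fun a' s_a' => le_k a' (or_intror s_a')).
lia.
Qed.

Lemma size_le_esize (A : encodable) (s : seq A) : size s < esize s.
Proof.
by elim: s => // a s IHs; rewrite esize_cons /=; have := esize_gt0 a; lia.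
Qed.

Lemma esize_in (A : encodable) (s : seq A) a :
  List.In a s -> esize a <= esize s.
Proof.
elim: s => //= b s IHs [-> | /IHs]; rewrite esize_cons; first by lia.
by move=> le_as; lia.
Qed.

(* The program uses the variables from [n] on, in any state, as workspace, with
   its input and output in [n]; it leaves the variables below [n] untouched,
   which is how a caller protects its own data. *)
Definition computes (A B : encodable) (n : nat) (c : cmd)
    (f : A -> B) (b : nat -> nat) : Prop :=
  forall (s : store) a, s n = encode a ->
    exists s' t, [/\ exec c s s' t, s' n = encode (f a),
      forall m, m < n -> s' m = s m & t <= b (esize a)].

(* Outputs must be bounded separately: with sharing, a program can produce a
   tree that is exponentially larger than its running time. *)
Definition ptime (A B : encodable) (f : A -> B) : Prop :=
  exists q : {poly nat}, (forall a, esize (f a) <= peval q (esize a)) /\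
    forall n, exists c, computes n c f (fun k => peval q k).

Section PtimeBasics.
Context {A B : encodable}.

Lemma ptime_intro (f : A -> B) (b : nat -> nat) :
  poly_bounded b -> (forall a, esize (f a) <= b (esize a)) ->
  (forall n, exists c, computes n c f b) -> ptime f.
Proof.
move=> [q bq] size_f comp_f; exists q; split=> [a|n].
  exact: leq_trans (size_f a) (bq _).
have [c comp_c] := comp_f n; exists c => s a /comp_c[s' [t [? ? ? le_t]]].
by exists s', t; split=> //; apply: leq_trans le_t (bq _).
Qed.

Lemma eq_ptime (f g : A -> B) : f =1 g -> ptime f -> ptime g.
Proof.
move=> fg [q [size_f comp_f]]; exists q; split=> [a|n]; first by rewrite -fg.
have [c comp_c] := comp_f n; exists c => s a /comp_c.
by rewrite fg.
Qed.

Lemma computes_load n c (f : A -> B) b e s a : computes n c f b ->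
  eval s e = encode a ->
  exists s' t, [/\ exec (Seq (Assign n e) c) s s' t, s' n = encode (f a),
    forall m, m < n -> s' m = s m & t <= b (esize a) + cost e + 2].
Proof.
move=> comp_c eval_e.
have upd_n : update s n (eval s e) n = encode a by rewrite /update eqxx.
have [s' [t [ex_c s'n s'lt le_t]]] := comp_c _ _ upd_n.
exists s', ((cost e).+1 + t).+1; split=> //; last by lia.
- exact: ExecSeq (ExecAssign _ _ _) ex_c.
- by move=> m lt_mn; rewrite s'lt // /update; case: eqP => // ?; lia.
Qed.

End PtimeBasics.

Section PtimeCore.
Context {A B C : encodable}.

Lemma ptime_expr (f : A -> B) (e : nat -> expr) k :
  (forall n, cost (e n) <= k) ->
  (forall n s a, s n = encode a -> eval s (e n) = encode (f a)) ->
  (forall a, esize (f a) <= k + esize a) -> ptime f.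
Proof.
move=> cost_e eval_e size_f; apply: (ptime_intro (b := fun n => (k + n).+1)).
- by poly_bounded_tac.
- by move=> a; rewrite leqW.
move=> n; exists (Assign n (e n)) => s a s_n.
exists (update s n (eval s (e n))), (cost (e n)).+1; split.
- exact: ExecAssign.
- by rewrite /update eqxx; apply: eval_e.
- by move=> m lt_mn; rewrite /update; case: eqP => // ?; lia.
- by have := cost_e n; lia.
Qed.

Lemma ptime_comp (g : B -> C) (f : A -> B) :
  ptime g -> ptime f -> ptime (fun a => g (f a)).
Proof.
move=> [qg [size_g comp_g]] [qf [size_f comp_f]].
apply: (ptime_intro (b := fun n => (peval qf n + peval qg (peval qf n)).+1)).
- by poly_bounded_tac.
- move=> a; apply: leq_trans (size_g _) _.
  by have := horner_le qg (size_f a); lia.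
move=> n; have [cf comp_cf] := comp_f n; have [cg comp_cg] := comp_g n.
exists (Seq cf cg) => s a s_n.
have [s1 [t1 [ex1 s1n s1lt le1]]] := comp_cf _ _ s_n.
have [s2 [t2 [ex2 s2n s2lt le2]]] := comp_cg _ _ s1n.
exists s2, (t1 + t2).+1; split=> //; first exact: ExecSeq ex1 ex2.
- by move=> m lt_mn; rewrite s2lt ?s1lt.
- by have := horner_le qg (size_f a); lia.
Qed.

(** The input stays in [n] while [f] works from [n.+1] on; [g] then works from [n.+2] on, which
    protects both the input and the result of [f]. *)
Lemma ptime_pair (f : A -> B) (g : A -> C) :
  ptime f -> ptime g -> ptime (fun a => (f a, g a)).
Proof.
move=> [qf [size_f comp_f]] [qg [size_g comp_g]].
apply: (ptime_intro (b := fun n => (peval qf n + peval qg n + 12))).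
- by poly_bounded_tac.
- by move=> a; rewrite esize_pair; have := size_f a; have := size_g a; lia.
move=> n; have [cf comp_cf] := comp_f n.+1; have [cg comp_cg] := comp_g n.+2.
exists (Seq (Seq (Assign n.+1 (Var n)) cf)
        (Seq (Seq (Assign n.+2 (Var n)) cg)
             (Assign n (Defs.Cons (Var n.+1) (Var n.+2))))) => s a s_n.
have [s1 [t1 [ex1 s1n s1lt le1]]] := computes_load (e := Var n) comp_cf s_n.
have s1_n : eval s1 (Var n) = encode a by rewrite /= s1lt.
have [s2 [t2 [ex2 s2n s2lt le2]]] := computes_load comp_cg s1_n.
eexists; eexists; split.
- apply: ExecSeq ex1 _; apply: ExecSeq ex2 _; exact: ExecAssign.
- by rewrite /update eqxx /= s2n s2lt // s1n.
- move=> m lt_mn; rewrite /update; case: eqP => [?|_]; first by lia.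
  by rewrite s2lt ?s1lt //; lia.
- by move: le1 le2; rewrite /=; lia.
Qed.

Lemma ptime_if (b : A -> bool) (f g : A -> B) :
  ptime b -> ptime f -> ptime g -> ptime (fun a => if b a then f a else g a).
Proof.
move=> [qb [size_b comp_b]] [qf [size_f comp_f]] [qg [size_g comp_g]].
apply: (ptime_intro (b := fun n => (peval qb n + peval qf n + peval qg n + 12))).
- by poly_bounded_tac.
- move=> a; have := size_f a; have := size_g a.
  by case: (b a); lia.
move=> n; have [cb comp_cb] := comp_b n.+1.
have [cf comp_cf] := comp_f n; have [cg comp_cg] := comp_g n.
exists (Seq (Seq (Assign n.+1 (Var n)) cb) (If (Var n.+1) cf cg)) => s a s_n.
have [s1 [t1 [ex1 s1n s1lt le1]]] := computes_load (e := Var n) comp_cb s_n.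
have s1_n : s1 n = encode a by rewrite s1lt.
have test : is_node (eval s1 (Var n.+1)) = b a by rewrite /= s1n; case: (b a).
have [s2 [t2 [ex2 s2n s2lt le2]]] : exists s' t, [/\
    exec (if b a then cf else cg) s1 s' t,
    s' n = encode (if b a then f a else g a),
    forall m, m < n -> s' m = s1 m
    & t <= (peval qf (esize a) + peval qg (esize a))].
  case: (b a).
    have [s' [t [? ? ? ?]]] := comp_cf _ _ s1_n; exists s', t; split=> //.
    by lia.
  have [s' [t [? ? ? ?]]] := comp_cg _ _ s1_n; exists s', t; split=> //.
  by lia.
eexists; eexists; split.
- apply: ExecSeq ex1 _; apply: ExecIf; rewrite test; exact: ex2.
- exact: s2n.
- by move=> m lt_mn; rewrite s2lt // s1lt // ; lia.
- by move: le1 le2; rewrite /=; lia.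
Qed.

End PtimeCore.

Fixpoint quote (x : tree) : expr :=
  if x is Node l r then Defs.Cons (quote l) (quote r) else Defs.Nil.

Lemma eval_quote s x : eval s (quote x) = x.
Proof. by elim: x => //= l -> r ->. Qed.

Section PtimePrimitives.
Context {X A B : encodable}.

Lemma ptime_id : ptime (fun x : X => x).
Proof. by apply: (ptime_expr (e := Var) (k := 1)) => // x; rewrite leq_addl. Qed.

Lemma ptime_const (a : A) : ptime (fun _ : X => a).
Proof.
apply: (ptime_expr (e := fun=> quote (encode a))
  (k := cost (quote (encode a)) + esize a)) => [n|n s x _|x]; last by lia.
- exact: leq_addr.
- exact: eval_quote.
Qed.

Lemma ptime_fst (f : X -> A * B) : ptime f -> ptime (fun x => (f x).1).
Proof.
apply: ptime_comp; apply: (ptime_expr (e := fun n => Hd (Var n)) (k := 2)) => //.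
- by move=> n s a /= ->.
- by move=> [a b]; rewrite esize_pair /=; lia.
Qed.

Lemma ptime_snd (f : X -> A * B) : ptime f -> ptime (fun x => (f x).2).
Proof.
apply: ptime_comp; apply: (ptime_expr (e := fun n => Tl (Var n)) (k := 2)) => //.
- by move=> n s a /= ->.
- by move=> [a b]; rewrite esize_pair /=; lia.
Qed.

Lemma ptime_cons (f : X -> A) (g : X -> seq A) :
  ptime f -> ptime g -> ptime (fun x => f x :: g x).
Proof.
move=> pf pg; have := ptime_pair pf pg.
apply: (ptime_comp (g := fun y : A * seq A => y.1 :: y.2)).
by apply: (ptime_expr (e := Var) (k := 1)).
Qed.

Lemma ptime_nilp (l : X -> seq A) : ptime l -> ptime (fun x => nilp (l x)).
Proof.
apply: (ptime_comp (g := fun s : seq A => nilp s)).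
apply: (ptime_intro (b := fun=> 9)); first exact: poly_bounded_const.
  by move=> s; apply: leq_trans (esize_bool _) _.
move=> n; exists (If (Var n) (Assign n (quote (enc_bool false)))
  (Assign n (quote (enc_bool true)))) => s a s_n.
exists (update s n (enc_bool (nilp a))); rewrite /update eqxx.
exists (if a is [::] then 6 else 4); split.
- rewrite -/(update s n _) -(eval_quote s (enc_bool (nilp a))).
  case: a s_n => [|a' r] s_n.
    apply: (@ExecIf (Var n) _ _ _ _ 4); rewrite /= s_n.
    exact: (ExecAssign n (quote (enc_bool true))).
  apply: (@ExecIf (Var n) _ _ _ _ 2); rewrite /= s_n.
  exact: (ExecAssign n (quote (enc_bool false))).
- by [].
- by move=> m lt_mn; case: eqP => // ?; lia.
- by case: a {s_n}.
Qed.

Lemma ptime_case (l : X -> seq A) (f : X -> A -> seq A -> B) (g : X -> B) :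
  ptime l -> ptime (fun y : X * (A * seq A) => f y.1 y.2.1 y.2.2) -> ptime g ->
  ptime (fun x => if l x is a :: r then f x a r else g x).
Proof.
move=> [ql [size_l comp_l]] [qf [size_f comp_f]] [qg [size_g comp_g]].
pose K k := (peval qf (k + peval ql k + 2)).
apply: (ptime_intro (b := fun k => (peval ql k + K k + peval qg k + 40))).
- by poly_bounded_tac.
- move=> x; have := size_g x; have := size_l x.
  case: (l x) => [|a r] le_l; first by lia.
  have mono : peval qf (esize (x, (a, r))) <= K (esize x).
    by apply: horner_le; rewrite !esize_pair; move: le_l; rewrite esize_cons; lia.
  by have := leq_trans (size_f (x, (a, r))) mono; move=> /= ?; lia.
move=> n; have [cl comp_cl] := comp_l n.+1; have [cf comp_cf] := comp_f n.+2.
have [cg comp_cg] := comp_g n.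
exists (Seq (Seq (Assign n.+1 (Var n)) cl) (If (Var n.+1)
  (Seq (Seq (Assign n.+2 (Defs.Cons (Var n) (Var n.+1))) cf) (Assign n (Var n.+2)))
  cg)) => s x s_n.
have [s1 [t1 [ex1 s1n s1lt le1]]] := computes_load (e := Var n) comp_cl s_n.
have s1_n : s1 n = encode x by rewrite s1lt.
have := size_l x; move: s1n; case: (l x) => [|a r] s1_l le_l.
  have [s2 [t2 [ex2 s2n s2lt le2]]] := comp_cg _ _ s1_n.
  exists s2; eexists; split.
  - by apply: ExecSeq ex1 _; apply: ExecIf; rewrite /= s1_l; exact: ex2.
  - exact: s2n.
  - by move=> m lt_mn; rewrite s2lt ?s1lt //; lia.
  - by move: le1 le2; rewrite /=; lia.
have eval_e : eval s1 (Defs.Cons (Var n) (Var n.+1)) = encode (x, (a, r)).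
  by rewrite /= s1_n s1_l.
have [s2 [t2 [ex2 s2n s2lt le2]]] := computes_load comp_cf eval_e.
exists (update s2 n (eval s2 (Var n.+2))); eexists; split.
- apply: ExecSeq ex1 _; apply: ExecIf; rewrite /= s1_l /=.
  apply: ExecSeq ex2 _; exact: ExecAssign.
- by rewrite /update eqxx.
- move=> m lt_mn; rewrite /update; case: eqP => [?|_]; first by lia.
  by rewrite s2lt ?s1lt //; lia.
- have mono : peval qf (esize (x, (a, r))) <= K (esize x).
    by apply: horner_le; rewrite !esize_pair; move: le_l; rewrite esize_cons; lia.
  by move: le1 le2 => /=; lia.
Qed.

End PtimePrimitives.

Section PtimeFoldl.
Context {X A B : encodable}.

Definition foldl_cmd (cl cz cF : cmd) (n : nat) : cmd :=
  Seq (Seq (Assign n.+1 (Var n)) cl)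
  (Seq (Seq (Assign n.+2 (Var n)) cz)
  (Seq (While (Var n.+1)
         (Seq (Seq (Assign n.+3 (Defs.Cons (Var n)
                      (Defs.Cons (Var n.+2) (Hd (Var n.+1))))) cF)
         (Seq (Assign n.+2 (Var n.+3)) (Assign n.+1 (Tl (Var n.+1))))))
       (Assign n (Var n.+2)))).

Lemma foldl_inv (F : B -> A -> B) (I : nat -> B -> Prop) z l :
  I 0 z -> (forall k b a, k < size l -> I k b -> List.In a l -> I k.+1 (F b a)) ->
  I (size l) (foldl F z l).
Proof.
elim: l I z => //= a l IHl I z Iz IF.
apply: (IHl (fun k => I k.+1)); first by apply: (IF 0) => //; left.
by move=> k b a' lt_k Ib l_a'; apply: IF => //; right.
Qed.

(** Iterating a polynomial-time step can square the accumulator each time. The invariant [I],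
    indexed by the number of elements consumed, therefore has to bound every accumulator by a
    polynomial in the size of the initial input. *)
Lemma ptime_foldl (F : X -> B -> A -> B) (z : X -> B) (l : X -> seq A)
    (I : X -> nat -> B -> Prop) (b : nat -> nat) :
  ptime (fun y : X * (B * A) => F y.1 y.2.1 y.2.2) -> ptime z -> ptime l ->
  (forall x, I x 0 (z x)) ->
  (forall x k acc a, k < size (l x) -> I x k acc -> List.In a (l x) ->
    I x k.+1 (F x acc a)) ->
  poly_bounded b ->
  (forall x k acc, k <= size (l x) -> I x k acc -> esize acc <= b (esize x)) ->
  ptime (fun x => foldl (F x) (z x) (l x)).
Proof.
move=> [qF [size_F comp_F]] [qz [size_z comp_z]] [ql [size_l comp_l]].
move=> Iz IF b_poly Ib.
have [qb bqb] := b_poly.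
(* [K] bounds one iteration: the step function on [(x, (acc, a))], with each component bounded
   through the size of [x], plus the fixed overhead of the loop body. *)
pose K k := (peval qF (k + peval qb k + peval ql k + 2)) + 40.
apply: (ptime_intro
  (b := fun k => peval qb k + peval qz k + peval ql k + peval ql k * K k + 50)).
- by poly_bounded_tac.
- move=> x.
  have le_f : esize (foldl (F x) (z x) (l x)) <= b (esize x).
    by apply: (Ib x _ _ (leqnn _)); apply: (foldl_inv (I := I x)) => //; apply: IF.
  by apply: leq_trans (leq_trans le_f (bqb _)) _; lia.
move=> n; have [cl comp_cl] := comp_l n.+1; have [cz comp_cz] := comp_z n.+2.
have [cF comp_cF] := comp_F n.+3.
exists (foldl_cmd cl cz cF n) => s x s_n.
have [s1 [t1 [ex1 s1n s1lt le1]]] := computes_load (e := Var n) comp_cl s_n.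
have s1_n : eval s1 (Var n) = encode x by rewrite /= s1lt.
have [s2 [t2 [ex2 s2n s2lt le2]]] := computes_load comp_cz s1_n.
have s2_n : s2 n = encode x by rewrite s2lt.
have s2_l : s2 n.+1 = encode (l x) by rewrite s2lt.
rewrite /foldl_cmd; set body := Seq (Seq (Assign n.+3 _) _) _.
have {}Iz := Iz x; have {}IF := IF x; have {}Ib := Ib x.
(* Loop invariant: variable [n] holds the input, [n.+1] the elements still to be consumed and [n.+2]
   the accumulator. *)
have loop : forall l' k acc (s3 : store), k + size l' = size (l x) -> I x k acc ->
    (forall a, List.In a l' -> List.In a (l x)) ->
    s3 n = encode x -> s3 n.+1 = encode l' -> s3 n.+2 = encode acc ->
  exists s' t, [/\ exec (While (Var n.+1) body) s3 s' t,
    s' n.+2 = encode (foldl (F x) acc l'), forall m, m <= n -> s' m = s3 m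
    & t <= size l' * K (esize x) + 2]; last first.
  have [s3 [t3 [ex3 s3n s3lt le3]]] :=
    loop _ _ _ _ (add0n _) Iz (fun _ => id) s2_n s2_l s2n.
  exists (update s3 n (eval s3 (Var n.+2))); eexists; split.
  - apply: ExecSeq ex1 _; apply: ExecSeq ex2 _; apply: ExecSeq ex3 _.
    exact: ExecAssign.
  - by rewrite /update eqxx.
  - move=> m lt_mn; rewrite /update; case: eqP => [?|_]; first by lia.
    by rewrite s3lt ?s2lt ?s1lt //; lia.
  - have: size (l x) * K (esize x) <= peval ql (esize x) * K (esize x).
      by rewrite leq_mul2r (leq_trans (ltnW (size_le_esize _)) (size_l _)) orbT.
    by move: le1 le2 le3; rewrite /=; lia.
elim=> [|a l' IHl] k acc s3 size_l' Iacc sub_l s3_n s3_l s3_acc.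
  exists s3, (cost (Var n.+1)).+1; split=> //.
  by apply: ExecWhileStop; rewrite /= s3_l.
pose arg := Defs.Cons (Var n) (Defs.Cons (Var n.+2) (Hd (Var n.+1))).
have eval_e : eval s3 arg = encode (x, (acc, a)) by rewrite /= s3_n s3_acc s3_l.
have [s4 [t4 [ex4 s4n s4lt le4]]] := computes_load comp_cF eval_e.
pose s5 := update s4 n.+2 (eval s4 (Var n.+3)).
pose s6 := update s5 n.+1 (eval s5 (Tl (Var n.+1))).
have upd s0 v m m' : m' != m -> update s0 m v m' = s0 m'.
  by rewrite /update => /negbTE->.
have s6_acc : s6 n.+2 = encode (F x acc a).
  by rewrite /s6 upd /s5 /update ?eqxx //= ?s4n //; lia.
have s6_n : s6 n = encode x.
  by rewrite /s6 upd /s5 ?upd ?s4lt //; lia.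
have s6_l : s6 n.+1 = encode l'.
  by rewrite /s6 {1}/update eqxx /= /s5 upd ?s4lt // ?s3_l //; lia.
have [||a' l'_a'|s7 [t7 [ex7 s7n s7lt le7]]] :=
  IHl k.+1 (F x acc a) s6 _ _ _ s6_n s6_l s6_acc.
- by rewrite addSnnS.
- by apply: IF => //; [rewrite -size_l' /= -addSnnS leq_addr | apply: sub_l; left].
- by apply: sub_l; right.
exists s7; eexists; split.
- apply: ExecWhileLoop ex7; first by rewrite /= s3_l.
  apply: ExecSeq ex4 _; apply: ExecSeq (ExecAssign _ _ _) (ExecAssign _ _ _).
- exact: s7n.
- by move=> m le_mn; rewrite s7lt // /s6 upd /s5 ?upd ?s4lt //; lia.
- have le_a := leq_trans (esize_in (sub_l a (or_introl erefl))) (size_l x).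
  have le_k : k <= size (l x) by rewrite -size_l' leq_addr.
  have le_acc := leq_trans (Ib _ _ le_k Iacc) (bqb _).
  have mono : peval qF (esize (x, (acc, a))) + 40 <= K (esize x).
    by rewrite leq_add2r; apply: horner_le; rewrite !esize_pair; lia.
  by move: le4 le7 => /=; lia.
Qed.

End PtimeFoldl.

Lemma ptime_app2 (X A B C : encodable) (f : A -> B -> C) (g : X -> A) (h : X -> B) :
  ptime (fun z : A * B => f z.1 z.2) -> ptime g -> ptime h ->
  ptime (fun x => f (g x) (h x)).
Proof. by move=> pf pg ph; apply: (ptime_comp pf (ptime_pair pg ph)). Qed.

Section PtimeBool.
Context {X : encodable}.
Implicit Types f g : X -> bool.

Lemma ptime_negb f : ptime f -> ptime (fun x => ~~ f x).
Proof. by move=> pf; apply: ptime_if => //; apply: ptime_const. Qed.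

Lemma ptime_andb f g : ptime f -> ptime g -> ptime (fun x => f x && g x).
Proof. by move=> pf pg; apply: ptime_if => //; apply: ptime_const. Qed.

Lemma ptime_orb f g : ptime f -> ptime g -> ptime (fun x => f x || g x).
Proof. by move=> pf pg; apply: ptime_if => //; apply: ptime_const. Qed.

Lemma ptime_eqb f g : ptime f -> ptime g -> ptime (fun x => f x == g x).
Proof.
move=> pf pg; apply: (eq_ptime (f := fun x => if f x then g x else ~~ g x)).
  by move=> x; case: (f x); case: (g x).
by apply: ptime_if => //; apply: ptime_negb.
Qed.

End PtimeBool.

Ltac ptime_tac :=
  repeat first
    [ assumption
    | lazymatch goal with
      | |- ptime (fun x => x) => apply: ptime_id
      | |- ptime id => apply: ptime_id
      | |- ptime fst => apply: (ptime_fst ptime_id)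
      | |- ptime snd => apply: (ptime_snd ptime_id)
      | |- ptime (fun _ => ?a) => apply: ptime_const
      | |- ptime (fun x => fst _) => apply: ptime_fst
      | |- ptime (fun x => snd _) => apply: ptime_snd
      | |- ptime (fun x => (_, _)) => apply: ptime_pair
      | |- ptime (fun x => _ :: _) => apply: ptime_cons
      | |- ptime (fun x => nilp _) => apply: ptime_nilp
      | |- ptime (fun x => ~~ _) => apply: ptime_negb
      | |- ptime (fun x => _ && _) => apply: ptime_andb
      | |- ptime (fun x => _ || _) => apply: ptime_orb
      | |- ptime (fun x => _ == _) => apply: ptime_eqb
      | |- ptime (fun x => if _ then _ else _) => apply: ptime_if
      end ].

Lemma ptime_size (A B : encodable) (f : A -> B) :
  ptime f -> exists q : {poly nat}, forall a, esize (f a) <= peval q (esize a).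
Proof. by move=> [q []]; exists q. Qed.

Section PtimeSeq.
Context {X A : encodable}.

Lemma ptime_has (P : X -> A -> bool) (l : X -> seq A) :
  ptime (fun y : X * A => P y.1 y.2) -> ptime l -> ptime (fun x => has (P x) (l x)).
Proof.
move=> pP pl.
apply: (eq_ptime (f := fun x => foldl (fun acc a => acc || P x a) false (l x))).
  move=> x; rewrite -[RHS]orFb; elim: (l x) false => [|a s IHs] b /=.
    by rewrite orbF.
  by rewrite IHs orbA.
apply: (ptime_foldl (I := fun _ _ _ => True) (b := fun=> 3)) => //.
- apply: ptime_orb; first by ptime_tac.
  by apply: (ptime_app2 pP); ptime_tac.
- exact: ptime_const.
- exact: poly_bounded_const.
- by move=> *; apply: esize_bool.
Qed.

Lemma ptime_all (P : X -> A -> bool) (l : X -> seq A) :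
  ptime (fun y : X * A => P y.1 y.2) -> ptime l -> ptime (fun x => all (P x) (l x)).
Proof.
move=> pP pl; apply: (eq_ptime (f := fun x => ~~ has (fun a => ~~ P x a) (l x))).
  by move=> x; rewrite has_predC negbK.
by apply/ptime_negb/ptime_has => //; apply: ptime_negb.
Qed.

Lemma ptime_rev (l : X -> seq A) : ptime l -> ptime (fun x => rev (l x)).
Proof.
apply: (ptime_comp (g := fun s : seq A => rev s)).
apply: (eq_ptime (f := foldl (fun acc a => a :: acc) [::])).
  move=> s; rewrite /rev; elim: s [::] => //= a s IHs t; exact: IHs.
apply: (ptime_foldl (I := fun s k acc => size acc = k /\
    forall a, List.In a acc -> List.In a s) (b := fun n => n * n.+1 + 1));
  try by ptime_tac.
- by move=> s k acc a _ [<- sub] s_a; split=> //= a' [<-|/sub].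
- by poly_bounded_tac.
move=> s k acc le_k [acc_k sub].
apply: leq_trans (esize_seq (k := esize s) _) _.
  by move=> a /sub; apply: esize_in.
by rewrite leq_add2r leq_mul // acc_k ltnW // (leq_ltn_trans le_k) ?size_le_esize.
Qed.

End PtimeSeq.

Section PtimeMap.
Context {X A B : encodable}.

Lemma ptime_map (f : X -> A -> B) (l : X -> seq A) :
  ptime (fun y : X * A => f y.1 y.2) -> ptime l -> ptime (fun x => map (f x) (l x)).
Proof.
move=> pf pl.
apply: (eq_ptime (f := fun x => rev (foldl (fun acc a => f x a :: acc) [::] (l x)))).
  move=> x; rewrite -[RHS](revK) -map_rev; congr rev.
  rewrite -[RHS]cats0; elim: (l x) [::] => //= a s IHs t.
  by rewrite IHs rev_cons map_rcons cat_rcons.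
apply: ptime_rev.
have [qf size_f] := ptime_size pf; have [ql size_l] := ptime_size pl.
apply: (ptime_foldl (I := fun x k acc => size acc = k /\
    forall b, List.In b acc -> exists2 a, List.In a (l x) & b = f x a)
  (b := fun n => peval ql n * (peval qf (n + peval ql n + 1)).+1 + 1)) => //.
- by apply: ptime_cons; ptime_tac; apply: (ptime_app2 pf); ptime_tac.
- exact: ptime_const.
- move=> x k acc a _ [<- sub] l_a; split=> //= b [<-|/sub //].
  by exists a.
- by poly_bounded_tac.
move=> x k acc le_k [acc_k sub]; have le_l := size_l x.
apply: leq_trans (esize_seq (k := peval qf (esize x + peval ql (esize x) + 1)) _) _.
  move=> b /sub[a l_a ->]; apply: leq_trans (size_f (x, a)) (horner_le _ _).
  by have := esize_in l_a; rewrite esize_pair; lia.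
rewrite leq_add2r leq_mul // acc_k (leq_trans le_k) //.
exact: leq_trans (ltnW (size_le_esize _)) le_l.
Qed.

Lemma ptime_zip (l : X -> seq A) (m : X -> seq B) :
  ptime l -> ptime m -> ptime (fun x => zip (l x) (m x)).
Proof.
move=> pl pm.
(* The state is the unread part of the second list together with the reversed result; once the
   second list is exhausted the state no longer changes. *)
pose F (st : seq B * seq (A * B)) a :=
  if st.1 is b :: r then (r, (a, b) :: st.2) else st.
apply: (eq_ptime (f := fun x => rev (foldl F (m x, [::]) (l x)).2)).
  move=> x; rewrite -[RHS]/(rev [::] ++ zip (l x) (m x)).
  elim: (l x) (m x) [::] => [|a s IHs] [|b t] w /=; rewrite ?cats0 //.
    by rewrite IHs; case: (s) => *; rewrite cats0.
  by rewrite IHs rev_cons cat_rcons.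
apply: ptime_rev; apply: ptime_snd.
have [ql size_l] := ptime_size pl; have [qm size_m] := ptime_size pm.
apply: (ptime_foldl (F := fun=> F) (I := fun x k st =>
    [/\ esize st.1 <= esize (m x), size st.2 <= k &
      forall ab, List.In ab st.2 -> esize ab <= (esize (l x) + esize (m x)).+1])
  (b := fun n => (peval qm n +
    (peval ql n * (peval ql n + peval qm n).+2 + 1)).+1)) => //.
- by rewrite /F; apply: ptime_case; ptime_tac.
- by ptime_tac.
- move=> x k [[|b r] w] a _ /= [le_m le_k le_w] l_a; split=> //=; first exact: leqW.
    by rewrite (leq_trans _ le_m) // esize_cons; lia.
  move=> ab [<-|/le_w //]; rewrite esize_pair.
  by have := esize_in l_a; move: le_m; rewrite esize_cons; lia.
- by poly_bounded_tac.
move=> x k [r w] le_k /= [le_r le_w le_el]; rewrite esize_pair.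
have le_l := size_l x; have le_m := size_m x.
rewrite ltnS leq_add //; first exact: leq_trans le_r le_m.
apply: leq_trans (esize_seq le_el) _; rewrite leq_add2r leq_mul //; last by lia.
apply: leq_trans le_w (leq_trans le_k _).
exact: leq_trans (ltnW (size_le_esize _)) le_l.
Qed.
End PtimeMap.

(** The list does not depend on the input, so the fold unrolls into a composition of fixed length,
    and its elements become part of the program text. *)
Lemma ptime_foldl_const (X B : encodable) (A : Type)
    (F : A -> X -> B -> B) (z : X -> B) (s : seq A) :
  (forall a, ptime (fun y : X * B => F a y.1 y.2)) -> ptime z ->
  ptime (fun x => foldl (fun b a => F a x b) (z x) s).
Proof.
move=> pF; elim: s z => [|a s IHs] z pz //=.
by apply: IHs; apply: (ptime_app2 (pF a)); ptime_tac.
Qed.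

Lemma ptime_eq_const (X : encodable) (s : seq bool) (f : X -> seq bool) :
  ptime f -> ptime (fun x => f x == s).
Proof.
elim: s X f => [|b s IHs] X f pf.
  apply: (eq_ptime (f := fun x => nilp (f x))); last exact: ptime_nilp.
  by move=> x; case: (f x).
apply: (eq_ptime (f := fun x => if f x is a :: r then (a == b) && (r == s) else false)).
  by move=> x; case: (f x).
apply: (ptime_case (f := fun _ (a : bool) (r : seq bool) => (a == b) && (r == s))) => //;
  last exact: ptime_const.
by apply: ptime_andb; [|apply: IHs]; ptime_tac.
Qed.

(** * Temporal distances *)

Section Reach.
Variables (V : finType) (G : tgraph V).

(** The vertices reached by time [t], computed one time-step at a time; this is what the algorithm
    simulates. *)
Fixpoint reach (s : V) (t : nat) : {set V} :=
  if t is t'.+1 then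
    reach s t' :|: [set v | [exists u in reach s t', adj G u v && times G u v t]]
  else [set s].

Lemma reachS s t v : (v \in reach s t.+1) =
  (v \in reach s t) || [exists u in reach s t, adj G u v && times G u v t.+1].
Proof. by rewrite /= !inE. Qed.

Lemma reach_mono s t t' v : t <= t' -> v \in reach s t -> v \in reach s t'.
Proof.
move=> /subnK <-; elim: (t' - t) => // k IHk /IHk.
by rewrite addSn reachS => ->.
Qed.

Lemma reach_hop s t t' u v : u \in reach s t -> hop G (u, t) (v, t') ->
  v \in reach s t'.
Proof.
case: t' => [|t'] s_u /and3P[/= adj_uv lt_tt' time_uv] //.
rewrite reachS; apply/orP; right; apply/existsP; exists u.
by rewrite (reach_mono _ s_u) // adj_uv.
Qed.

(** Times increase along a temporal walk, so each of its vertices is reached no later than the last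
    one. Both comparisons of [reach] with journeys rest on this. *)
Lemma reach_path s x js : x.1 \in reach s x.2 -> path (hop G) x js ->
  all (fun y => (y.2 <= (last x js).2) && (y.1 \in reach s y.2)) (x :: js).
Proof.
elim: js x => [|y js IHjs] x s_x /=; first by rewrite leqnn s_x.
case/andP=> hop_xy path_y.
have s_y : y.1 \in reach s y.2.
  by case: x y hop_xy s_x {path_y} => [u t] [v t'] hop_xy /reach_hop; apply.
have IH := IHjs y s_y path_y; apply/andP; split; last exact: IH.
rewrite s_x andbT; have /andP[/andP[le_y _] _] := IH.
by apply: leq_trans le_y; case/and3P: hop_xy => _ /ltnW.
Qed.

Lemma arrives_reach s v t : arrives G s v t -> v \in reach s t.
Proof.
move=> [js /andP[path_js _] last_js].
have /allP/(_ (v, t)) := @reach_path s (s, 0) js (set11 s) path_js.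
by rewrite -last_js mem_last last_js /= => /(_ isT)/andP[].
Qed.

(** A vertex that is new at time [t.+1] extends a journey to its predecessor. The result is still a
    simple path, since all vertices of that journey were reached by time [t] and the new one was
    not. *)
Lemma reach_arrives s v t : v \in reach s t -> exists2 t', t' <= t & arrives G s v t'.
Proof.
elim: t v => [|t IHt] v; first by move/set1P->; exists 0 => //; exists [::].
rewrite reachS; case: (boolP (v \in reach s t)) => [s_v _|s'v /=].
  by have [t' le_t' arr_v] := IHt v s_v; exists t' => //; apply: leqW.
case/existsP=> u /and3P[s_u adj_uv time_uv].
have [t' le_t' [js /andP[path_js uniq_js] last_js]] := IHt u s_u.
exists t.+1 => //; exists (rcons js (v, t.+1)); last by rewrite last_rcons.
rewrite /journey map_rcons -rcons_cons rcons_uniq uniq_js andbT.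
rewrite rcons_path path_js last_js /hop /= adj_uv time_uv ltnS le_t' /=.
apply: contra s'v; rewrite -(map_cons fst (s, 0)) => /mapP[y js_y ->].
have /allP/(_ y js_y)/andP[le_y s_y] := @reach_path s (s, 0) js (set11 s) path_js.
by apply: reach_mono s_y; apply: leq_trans le_y _; rewrite last_js.
Qed.

(* Meaningful only if [v] is reached from [s]. *)
Definition dist (s v : V) : nat := odflt 0 (tdist G s v).

Lemma tdistE s v t : v \in reach s t -> tdist G s v = Some (dist s v).
Proof.
move=> /reach_arrives[t' _ arr_v]; rewrite /dist /tdist.
case: boolp.pselect => // no_t; case: no_t; exists t'; exact/boolp.asboolP.
Qed.

Lemma reachE s v t : (exists t', v \in reach s t') ->
  (v \in reach s t) = (dist s v <= t).
Proof.
move=> [t' s_v]; have := tdistE s_v; rewrite /dist /tdist.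
case: boolp.pselect => // ex_t _; case: ex_minnP => /= d /boolp.asboolP arr_v min_d.
apply/idP/idP=> [/reach_arrives[t0 le_t0 arr_t0]|le_dt].
  by apply: leq_trans le_t0; apply/min_d/boolp.asboolP.
exact: reach_mono (arrives_reach arr_v).
Qed.

End Reach.

(** * Waiting times modulo the period *)

Section Periodic.
Variables (p : nat) (p_gt0 : 0 < p).

(** The first time after [t] congruent to [l] modulo [p]; the term [p.-1 * t.+1] stands for the
    negative of [t.+1] modulo [p]. *)
Definition next_time (t l : nat) : nat := t.+1 + (l + p.-1 * t.+1) %% p.

Lemma next_time_mod t l : next_time t l = l %[mod p].
Proof.
by rewrite /next_time modnDmr addnCA -mulSn prednK // mulnC addnC modnMDl.
Qed.

Lemma ltn_next_time t l : t < next_time t l. Proof. by rewrite /next_time leq_addr. Qed.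

Lemma next_time_le t l : next_time t l <= t + p.
Proof. by rewrite /next_time addSn -addnS leq_add2l ltn_mod. Qed.

Lemma next_time_min t l t' : t < t' -> t' = l %[mod p] -> next_time t l <= t'.
Proof.
move=> /subnKC <- eq_l; rewrite leq_add2l; set d := t' - t.+1 in eq_l *.
rewrite -modnDml -eq_l modnDml addnAC -mulSn prednK // mulnC modnMDl.
exact: leq_mod.
Qed.

(** The wait depends only on the residue of the current time; the equality of the two waits is
    written without subtraction. *)
Lemma next_time_shift t t' l : t = t' %[mod p] -> next_time t l + t' = next_time t' l + t.
Proof.
move=> eq_t; rewrite /next_time.
have -> : (l + p.-1 * t.+1) %% p = (l + p.-1 * t'.+1) %% p.
  have eq_t1 : t.+1 = t'.+1 %[mod p].
    by rewrite -[t.+1]addn1 -[t'.+1]addn1 -modnDml eq_t modnDml.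
  apply/eqP; rewrite eqn_modDl -(modnMmr _ t.+1) eq_t1 modnMmr.
  by [].
by lia.
Qed.

(** The lower bound of the progression is automatic: a positive time below a label that is at most
    [p] is not congruent to that label. *)
Lemma progression_next t l t' : 0 < l <= p -> t < t' ->
  progression p l t' = (t' == l %[mod p]).
Proof.
move=> /andP[l_gt0 le_lp] lt_tt'; rewrite /progression.
case: eqP => [eq_l|_]; last by rewrite andbF.
rewrite andbT leqNgt; apply/negP => lt_t'l.
move: eq_l; rewrite modn_small; last by apply: leq_trans lt_t'l le_lp.
move: le_lp; rewrite leq_eqVlt => /orP[/eqP->|lt_lp]; first by rewrite modnn; lia.
by rewrite modn_small //; lia.
Qed.

End Periodic.

(** * Distances in connected periodic graphs *)

Section PeriodicReach.
Variables (p : nat) (p_gt0 : 0 < p) (P : periodic_tgraph p).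
Local Notation V := 'I_(nvertices P).
Local Notation G := (tgraph_of P).
Local Notation next_time := (next_time p).
Implicit Types s u v : V.

Lemma label_next u v t t' : pgraph P u v -> t < t' ->
  times G u v t' = (t' == label P u v %[mod p]).
Proof. by move=> /label_range; apply: progression_next. Qed.

Lemma reach_next s u v t : u \in reach G s t -> pgraph P u v ->
  v \in reach G s (next_time t (label P u v)).
Proof.
move=> s_u adj_uv; apply: reach_hop s_u _; apply/and3P; split=> //=.
  exact: ltn_next_time.
have /= -> := label_next adj_uv (ltn_next_time p t (label P u v)).
by rewrite next_time_mod.
Qed.

Lemma reach_walk s w : path (pgraph P) s w -> last s w \in reach G s (p * size w).
Proof.
elim/last_ind: w => [|w v IHw]; first by rewrite muln0 set11.
rewrite rcons_path last_rcons size_rcons => /andP[/IHw s_w adj_wv].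
by apply: reach_mono (reach_next s_w adj_wv); rewrite mulnS addnC next_time_le.
Qed.

(** A simple path has fewer edges than the graph has vertices, and each edge costs at most [p]
    time-steps. *)
Lemma reach_connect s v : connect (pgraph P) s v ->
  v \in reach G s (p * (nvertices P).-1).
Proof.
case/connectP=> w /shortenP[w' path_w' uniq_w' _] ->.
apply: reach_mono (reach_walk path_w'); rewrite leq_mul2l.
have := max_card [in s :: w']; rewrite card_ord (card_uniqP uniq_w') /=.
by move=> lt_w'; rewrite -ltnS prednK ?lt_w' ?orbT // (leq_ltn_trans _ lt_w').
Qed.

Hypothesis conn : forall u v, connect (pgraph P) u v.

Lemma reach_distE s v t : (v \in reach G s t) = (dist G s v <= t).
Proof. by apply: reachE; exists (p * (nvertices P).-1); apply: reach_connect. Qed.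

Lemma tdist_dist s v : tdist G s v = Some (dist G s v).
Proof. exact: tdistE (reach_connect (conn s v)). Qed.

Lemma dist_le s v : dist G s v <= p * (nvertices P).-1.
Proof. by rewrite -reach_distE reach_connect. Qed.

(* The edge {u, v} is a bridge, with [v] on the side [B] away from [s]. *)
Lemma dist_bridge (B : pred V) s u v :
  ~~ B s -> ~~ B u -> B v -> pgraph P u v ->
  (forall x y, ~~ B x -> B y -> pgraph P x y -> x = u /\ y = v) ->
  dist G s v = next_time (dist G s u) (label P u v).
Proof.
move=> B's B'u Bv adj_uv bridge.
apply/eqP; rewrite eqn_leq -reach_distE reach_next ?reach_distE //=.
rewrite leqNgt; apply/negP => lt_next.
(* Nothing in [B] is reached before the bridge can be crossed: a first vertex of [B] would be
   entered over the bridge, after [u] is reached and at a time carrying its label. *)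
suff unreached t : t < next_time (dist G s u) (label P u v) ->
    forall y, B y -> y \notin reach G s t.
  by have /negP[] := unreached _ lt_next v Bv; rewrite reach_distE.
elim: t => [_ y By|t IHt lt_t y By].
  by apply: contraNN B's => /set1P <-.
rewrite reachS negb_or IHt ?(ltnW lt_t) //=; apply/existsP => -[x].
case/and3P=> s_x adj_xy time_xy.
have B'x : ~~ B x by apply: contraL s_x => Bx; apply: IHt Bx; apply: ltnW.
have [eq_x eq_y] := bridge _ _ B'x By adj_xy; subst x y.
move: s_x; rewrite reach_distE => le_t.
have lt_u : dist G s u < t.+1 by [].
have /eqP eq_t : t.+1 == label P u v %[mod p] by rewrite -(label_next adj_uv lt_u).
by have := next_time_min p_gt0 lt_u eq_t; rewrite leqNgt lt_t.
Qed.

(** By connectivity all distances are finite, so the covering condition only says that [R] is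
    nonempty. *)
Lemma resolvingE (R : {set V}) : 0 < nvertices P ->
  temporal_resolving G R <->
  R != set0 /\ forall u v, u != v -> exists2 s, s \in R & dist G s u != dist G s v.
Proof.
move=> n_gt0; split=> [[cov sep]|[/set0Pn[s Rs] sep]]; split.
- by have [s Rs _] := cov (Ordinal n_gt0); apply/set0Pn; exists s.
- move=> u v /sep[s Rs neq]; exists s => //; apply: contra_notN neq => /eqP eq_d.
  by rewrite !tdist_dist eq_d.
- move=> v; exists s => //.
  by have [t _ arr_t] := reach_arrives (reach_connect (conn s v)); exists t.
- move=> u v /sep[s' Rs' neq]; exists s' => //; rewrite !tdist_dist => -[eq_d].
  by rewrite eq_d eqxx in neq.
Qed.

End PeriodicReach.

(** * Resolving sets of subdivided stars *)

Section Star.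
Variables (p : nat) (p_gt0 : 0 < p) (P : periodic_tgraph p).
Local Notation V := 'I_(nvertices P).
Local Notation G := (tgraph_of P).
Local Notation next_time := (next_time p).
Variables (m : nat) (l : 'I_m -> nat).
Variables (f : V -> sstar_vertex l) (g : sstar_vertex l -> V).
Hypotheses (fK : cancel f g) (gK : cancel g f).
Hypothesis adjE : forall u v, pgraph P u v = sstar_adj (f u) (f v).
Implicit Types (s u v x y : V) (i j : 'I_m).

Let centre : V := g None.

(* [leg i 0] is the centre and [leg i (l i).+1] the leaf of the i-th leg. *)
Definition leg i k : V :=
  if k is k'.+1 then g (Some (existT (fun i => 'I_(l i).+1) i (inord k'))) else centre.

Definition tip i : V := leg i (l i).+1.

(* The vertices of the i-th leg strictly beyond [leg i k]. *)
Definition beyond i k v : bool :=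
  if f v is Some a then (tag a == i) && (k <= tagged a) else false.

Lemma f_leg i k : f (leg i k.+1) = Some (existT (fun i => 'I_(l i).+1) i (inord k)).
Proof. by rewrite /leg gK. Qed.

Lemma legP v : v = centre \/ exists i k, k <= l i /\ v = leg i k.+1.
Proof.
rewrite -(fK v); case: (f v) => [[i k]|]; last by left.
by right; exists i, k; rewrite -ltnS ltn_ord /= inord_val.
Qed.

Lemma beyond_leg i j k k' : k' <= l j ->
  beyond i k (leg j k'.+1) = (j == i) && (k <= k').
Proof. by move=> le_k'; rewrite /beyond f_leg /= inordK. Qed.

Lemma beyond_centre i k : beyond i k centre = false.
Proof. by rewrite /beyond gK. Qed.

Lemma adj_leg i k : k <= l i -> pgraph P (leg i k) (leg i k.+1).
Proof.
move=> le_k; rewrite adjE /sstar_adj f_leg; apply/orP; left.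
case: k le_k => [|k] le_k; rewrite /= ?gK /= ?inordK //.
  by rewrite !eqxx.
exact: ltnW.
Qed.

(** Every edge of a leg is a bridge; this supplies the cut condition of [dist_bridge]. *)
Lemma bridge_leg i k x y : ~~ beyond i k x -> beyond i k y -> pgraph P x y ->
  x = leg i k /\ y = leg i k.+1.
Proof.
rewrite /beyond adjE /sstar_adj; move: (fK x) (fK y).
case: (f y) => // -[i' b] /= + + + /andP[/eqP eq_i le_kb]; subst i'.
case: (f x) => [[i' a]|] /= <- <-.
  have [eq_i|_] := eqVneq i' i; last by [].
 
  subst i'; rewrite /= ?eqxx -ltnNge => lt_ak /orP[]/eqP eq_ab; last by lia.
  have {le_kb} eq_k : k = a.+1 by lia.
  by subst k; rewrite /leg inord_val -eq_ab inord_val.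
rewrite orbF => _ /eqP b0; have k0 : k = 0 by lia.
by subst k; rewrite /leg -b0 inord_val.
Qed.

Lemma star_connected u v : connect (pgraph P) u v.
Proof.
have sym : connect_sym (pgraph P) by apply: sym_connect_sym; apply: adj_sym.
suff from_centre w : connect (pgraph P) centre w.
  by apply: connect_trans (from_centre v); rewrite sym.
case: (legP w) => [->|[i [k [le_k ->]]]]; first exact: connect0.
elim: k.+1 (le_k : k.+1 <= (l i).+1) => {k le_k} [|k IHk] le_k; first exact: connect0.
by apply: connect_trans (IHk (ltnW le_k)) (connect1 (adj_leg _)).
Qed.

Local Notation dist_bridge := (dist_bridge p_gt0 star_connected).

Lemma dist_outward s i k : k <= l i -> ~~ beyond i k s ->
  dist G s (leg i k.+1) = next_time (dist G s (leg i k)) (label P (leg i k) (leg i k.+1)).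
Proof.
move=> le_k s_near; apply: (dist_bridge (B := beyond i k)) => //.
- by case: k le_k {s_near} => [|k] le_k;
    rewrite ?beyond_centre ?beyond_leg ?ltnn ?andbF // ltnW.
- by rewrite beyond_leg // eqxx leqnn.
- exact: adj_leg.
- exact: bridge_leg.
Qed.

Lemma dist_inward s i k : k <= l i -> beyond i k s ->
  dist G s (leg i k) = next_time (dist G s (leg i k.+1)) (label P (leg i k.+1) (leg i k)).
Proof.
move=> le_k s_far; apply: (dist_bridge (B := fun v => ~~ beyond i k v)).
- by rewrite negbK.
- by rewrite negbK beyond_leg // eqxx leqnn.
- by case: k le_k {s_far} => [|k] le_k;
    rewrite ?beyond_centre ?beyond_leg ?ltnn ?andbF // ltnW.
- by rewrite adj_sym adj_leg.
move=> x y; rewrite negbK => x_far y_near; rewrite adj_sym => adj_yx.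
by have [-> ->] := bridge_leg y_near x_far adj_yx.
Qed.

(** Both sources reach the centre at times congruent to the label of the first edge of leg [i]. From
    there all waits agree, by induction outwards along another leg, so the two distance functions
    differ by a constant outside leg [i]. *)
Lemma dist_shift s s' v i : beyond i 0 s -> beyond i 0 s' -> ~~ beyond i 0 v ->
  dist G s v + dist G s' centre = dist G s' v + dist G s centre.
Proof.
move=> s_i s'_i v_i.
have centre_mod : dist G s centre = dist G s' centre %[mod p].
  by rewrite !(@dist_inward _ i 0) // !next_time_mod.
case: (legP v) => [->|[j [k [le_k eq_v]]]]; first by rewrite addnC.
move: v_i; rewrite {}eq_v beyond_leg // andbT => neq_ji.
have near k' x : beyond i 0 x -> ~~ beyond j k' x.
  rewrite /beyond; case: (f x) => // a /andP[tag_a _].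
  by apply: contra neq_ji => /andP[/eqP <- _].
elim: k.+1 (le_k : k.+1 <= (l j).+1) => {k le_k} [|k IHk] le_k; first by rewrite addnC.
have {}IHk := IHk (ltnW le_k).
rewrite !(@dist_outward _ j k) ?near //.
set t := dist G s (leg j k) in IHk *; set t' := dist G s' (leg j k) in IHk *.
have eq_t : t = t' %[mod p].
  apply/eqP; rewrite -(eqn_modDr (dist G s' centre)) IHk eqn_modDl.
  exact/eqP.
by have := next_time_shift p_gt0 (label P (leg j k) (leg j k.+1)) eq_t; lia.
Qed.

Lemma dist_tip_decr i k k' : k < k' -> k' <= (l i).+1 ->
  dist G (tip i) (leg i k') < dist G (tip i) (leg i k).
Proof.
elim: k' => // k' IHk'; rewrite !ltnS leq_eqVlt => lt_k le_k'.
have step : dist G (tip i) (leg i k'.+1) < dist G (tip i) (leg i k').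
  rewrite [X in _ < X]dist_inward ?ltn_next_time // beyond_leg // eqxx.
  by [].
case/orP: lt_k => [/eqP -> //|lt_k].
exact: ltn_trans step (IHk' lt_k (leqW le_k')).
Qed.

Lemma dist_tip_centre i v : ~~ beyond i 0 v ->
  dist G (tip i) centre <= dist G (tip i) v.
Proof.
case: (legP v) => [->|[j [k [le_k ->]]]] //.
rewrite beyond_leg // andbT => neq_ji.
elim: k.+1 (le_k : k.+1 <= (l j).+1) => {k le_k} [|k IHk] le_k //.
rewrite dist_outward //; last by rewrite beyond_leg // eq_sym (negbTE neq_ji).
exact: leq_trans (IHk (ltnW le_k)) (ltnW (ltn_next_time _ _ _)).
Qed.

(** From the leaf, distances strictly increase towards the centre, and a vertex outside the leg is
    at least as far as the centre. *)
Lemma dist_tip_neq i u v : beyond i 0 u -> u != v ->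
  dist G (tip i) u != dist G (tip i) v.
Proof.
case: (legP u) => [->|[j [k [le_k ->]]]]; first by rewrite beyond_centre.
rewrite beyond_leg // andbT => /eqP eq_j; subst j.
have [v_i neq_uv|v_i _] := boolP (beyond i 0 v); last first.
  rewrite neq_ltn; apply/orP; left; apply: leq_trans (dist_tip_centre v_i).
  exact: (@dist_tip_decr i 0).
case: (legP v) v_i neq_uv => [->|[j [k' [le_k' ->]]]]; first by rewrite beyond_centre.
rewrite beyond_leg // andbT => /eqP eq_j; subst j.
rewrite neq_ltn; case: (ltngtP k k') => [lt_k _|lt_k _|->]; last by rewrite eqxx.
  by rewrite [X in _ || X]dist_tip_decr ?orbT.
by rewrite dist_tip_decr.
Qed.

Definition to_tip v : V := if f v is Some a then tip (tag a) else v.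

(** A pair that meets the leg of [s] is separated by its leaf through [dist_tip_neq]; any other pair
    separated by [s] is also separated by the leaf through [dist_shift]. *)
Lemma to_tip_resolving R : temporal_resolving G R -> temporal_resolving G (to_tip @: R).
Proof.
have n_gt0 : 0 < nvertices P := leq_trans (ltn0Sn _) (ltn_ord centre).
rewrite !(resolvingE p_gt0 star_connected) // => -[/set0Pn[s0 Rs0] sep]; split.
  by apply/set0Pn; exists (to_tip s0); apply: imset_f.
move=> u v neq_uv; have [s Rs neq] := sep u v neq_uv.
exists (to_tip s); first exact: imset_f.
rewrite /to_tip; case def_s: (f s) => [a|//].
have s_i : beyond (tag a) 0 s by rewrite /beyond def_s eqxx.
have tip_i : beyond (tag a) 0 (tip (tag a)) by rewrite beyond_leg ?eqxx.
have [u_i|u_i] := boolP (beyond (tag a) 0 u); first exact: dist_tip_neq.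
have [v_i|v_i] := boolP (beyond (tag a) 0 v).
  by rewrite eq_sym dist_tip_neq // eq_sym.
apply: contra neq => /eqP eq_d.
have := dist_shift s_i tip_i u_i; have := dist_shift s_i tip_i v_i.
by rewrite eq_d => shift_v shift_u; apply/eqP; lia.
Qed.

(* Two legs that avoid [R] and have the same label at the centre would have
   indistinguishable first vertices. *)
Lemma card_unmarked_legs R : temporal_resolving G R ->
  #|[set i | [forall s in R, ~~ beyond i 0 s]]| <= p.+1.
Proof.
have n_gt0 : 0 < nvertices P := leq_trans (ltn0Sn _) (ltn_ord centre).
rewrite (resolvingE p_gt0 star_connected) // => -[_ sep].
(* Labels lie between 1 and [p] and are stored unshifted in ['I_p.+1], whence the bound [p.+1]. *)
set J := [set i | _]; pose h i : 'I_p.+1 := inord (label P centre (leg i 1)).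
have h_inj : {in J &, injective h}.
  move=> i j; rewrite !inE => /forall_inP Ji /forall_inP Jj /(congr1 val) /=.
  have le_p k : label P centre (leg k 1) < p.+1.
    by have /andP[] := label_range (@adj_leg k 0 isT).
  rewrite !inordK // => eq_lab; apply/eqP; apply: contraT => neq_ij.
  have /sep[s Rs] : leg i 1 != leg j 1.
    apply: contra neq_ij => /eqP/(congr1 f); rewrite !f_leg => -[/eqP].
    by [].
  by rewrite !dist_outward ?Ji ?Jj //= eq_lab eqxx.
by rewrite -(card_in_imset h_inj) (leq_trans (max_card _)) ?card_ord.
Qed.

Lemma tip_beyond i : beyond i 0 (tip i).
Proof. by rewrite beyond_leg ?eqxx. Qed.

Lemma tip_inj : injective tip.
Proof.
move=> i j eq_tip; have := tip_beyond i.
by rewrite eq_tip beyond_leg // andbT => /eqP.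
Qed.

(** Leaves can thus be read off the degrees, without access to the leg structure. The centre is a
    fixed point of [to_tip] whatever its degree. *)
Lemma degree_tip v : v != centre -> (#|pgraph P v| <= 1) = (v == to_tip v).
Proof.
case: (legP v) => [->|[i [k [le_k ->]]]]; first by rewrite eqxx.
have adj_k := adj_leg le_k; rewrite adj_sym in adj_k => _.
rewrite /to_tip f_leg /=; apply/idP/eqP => [|eq_v].
  rewrite leqNgt => deg_gt1; move: le_k; rewrite leq_eqVlt => /orP[/eqP->//|lt_k].
  case/negP: deg_gt1; apply/card_gt1P; exists (leg i k), (leg i k.+2).
  split; [exact: adj_k | exact: (@adj_leg i k.+1) |].
  apply/eqP => /(congr1 (beyond i k.+1)); rewrite beyond_leg // eqxx leqnn.
  case: k lt_k {adj_k} => [|k] lt_k; first by rewrite beyond_centre.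
  have le_k : k <= l i by lia.
  by rewrite beyond_leg // eqxx ltnNge leqnSn.
have {eq_v} k_max : k = l i.
  have := congr1 (beyond i (l i)) eq_v; rewrite !beyond_leg // !eqxx leqnn /=.
  by lia.
subst k; apply/card_le1_eqP => x y; rewrite !unfold_in.
suff only_adj z : pgraph P (leg i (l i).+1) z -> z = leg i (l i).
  by move=> /only_adj -> /only_adj ->.
have [z_far|z_near] := boolP (beyond i (l i) z); last first.
  rewrite adj_sym => adj_z.
  have tip_far : beyond i (l i) (leg i (l i).+1) by rewrite beyond_leg ?eqxx ?leqnn.
  by have [] := bridge_leg z_near tip_far adj_z.
have -> : z = leg i (l i).+1; last by rewrite adj_irr.
case: (legP z) z_far => [->|[j [k [le_kj ->]]]]; first by rewrite beyond_centre.
rewrite beyond_leg // => /andP[/eqP eq_j le_ik]; subst j.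
by congr (leg i _.+1); lia.
Qed.

(** The new set is [to_tip @: R]: the leaves of the legs that meet [R], with the centre if [R]
    contains it. It arises from the vertices of degree at most one by deleting the leaves of
    unmarked legs and the centre, whose degree may be small too, and adding [w]. *)
Lemma small_resolving R : temporal_resolving G R ->
  exists (a : seq V) (w : V), size a = p.+2 /\
    let R' := [set v | (v == w) || ((#|pgraph P v| <= 1) && (v \notin a))] in
    temporal_resolving G R' /\ #|R'| <= #|R|.
Proof.
move=> resR; have := card_unmarked_legs resR.
set J := [set i | _] => cardJ.
have [s0 Rs0 _] := resR.1 centre.
pose b := centre :: [seq tip i | i in J].
have size_b : size b <= p.+2 by rewrite /= size_map -cardE.
(* There are at most [p.+1] unmarked legs, and the centre is one more entry; repeating it pads the
   list to exactly [p.+2] without changing its elements. *)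
exists (b ++ nseq (p.+2 - size b) centre).
(* Either [w] restores the deleted centre, or it already belongs to the image and adding it changes
   nothing. *)
exists (if centre \in R then centre else to_tip s0).
rewrite size_cat size_nseq subnKC //; split=> //.
set w := if _ then _ else _; move=> R'.
suff -> : R' = to_tip @: R.
  by split; [apply: to_tip_resolving | apply: leq_imset_card].
have tip_c : to_tip centre = centre by rewrite /to_tip gK.
have in_b v : (v \in b ++ nseq (p.+2 - size b) centre) = (v \in b).
  by rewrite mem_cat mem_nseq inE; case: eqP => [->|_]; rewrite ?orbT ?andbF ?orbF.
have w_img : w \in to_tip @: R.
  rewrite /w; case: ifP => [Rc|_]; last exact: imset_f.
  by rewrite -{1}tip_c imset_f.
apply/setP => v; rewrite inE in_b; apply/orP/imsetP => [[/eqP->|]|[s Rs ->]].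
- by apply/imsetP.
- case/andP=> deg_v; rewrite inE negb_or => /andP[v_c v_J].
  move: deg_v; rewrite degree_tip // => /eqP; rewrite /to_tip.
  case def_v: (f v) => [a|] eq_v; last by move: v_c; rewrite -(fK v) def_v eqxx.
  have : tag a \notin J by apply: contra v_J => Ja; rewrite eq_v map_f ?mem_enum.
  rewrite inE negb_forall => /existsP[s]; rewrite negb_imply negbK => /andP[Rs].
  rewrite /beyond; case def_s: (f s) => [a'|//] /andP[/eqP eq_a _].
  by exists s => //; rewrite def_s eq_a.
case def_s: (f s) => [a|]; last first.
  left; move: Rs; rewrite -(fK s) def_s => Rc.
  by rewrite tip_c /w Rc.
right; have eq_s : to_tip s = tip (tag a) by rewrite /to_tip def_s.
have neq_c : tip (tag a) != centre.
  by apply: contraTneq (tip_beyond (tag a)) => ->; rewrite beyond_centre.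
rewrite eq_s degree_tip // /to_tip f_leg eqxx inE negb_or neq_c /=.
apply/negP => /mapP[i]; rewrite mem_enum inE => /forall_inP Ji /tip_inj eq_i.
by have := Ji s Rs; rewrite /beyond def_s -eq_i eqxx.
Qed.

End Star.

(** * The algorithm *)

Local Notation bits := (seq bool).
Local Notation label_matrix := (seq (seq bits)).

Definition nat_bits (n : nat) : bits :=
  if bin_of_nat n is Npos n' then pos_bits n' else [::].

(** Vertex sets are bit vectors and a single vertex is a unit vector, so this test also expresses
    membership and equality of vertices. *)
Definition meets (a b : bits) : bool := has (fun z => z.1 && z.2) (zip a b).

Definition bits_diff (a b : bits) : bits := map (fun z => z.1 && ~~ z.2) (zip a b).

Definition bits_union (a b : bits) : bits := map (fun z => z.1 || z.2) (zip a b).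

(** The unit vectors; each row of [M] only serves to increase the dimension by one. *)
Definition basis (M : label_matrix) : seq bits :=
  foldl (fun acc _ => (true :: map (fun=> false) acc) :: map (cons false) acc) [::] M.

(** The two flags record whether at least one and at least two neighbours have been seen. *)
Definition low_degree (M : label_matrix) : bits :=
  map (fun r : seq bits => ~~ (foldl (fun (ab : bool * bool) x =>
    if nilp x then ab else (true, ab.1 || ab.2)) (false, false) r).2) M.

Definition step (lab : nat) (M : label_matrix) (cur : bits) : bits :=
  map (fun z => z.2 || has (fun y => y.2 && (y.1 == nat_bits lab)) (zip z.1 cur))
      (zip M cur).

(** The rows of [M] count the rounds, of [p] time-steps each. The flag is raised when, just before
    some time-step, exactly one of the two targets has been reached. *)
Definition separates p (M : label_matrix) (s e e' : bits) : bool :=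
  (foldl (fun st _ => foldl (fun (st : bits * bool) lab =>
       (step lab M st.1, st.2 || ~~ (meets st.1 e == meets st.1 e'))) st (iota 1 p))
     (s, false) M).2.

Definition resolves p (M : label_matrix) (R : bits) : bool :=
  all (fun e => all (fun e' =>
    meets e e' || has (fun s => meets s R && separates p M s e e') (basis M))
  (basis M)) (basis M).

(* Keeps every other [true]: the first, the third, ... if [keep]. *)
Definition halve (keep : bool) (R : bits) : bits :=
  (foldl (fun st (x : bool) =>
     if x then (~~ st.1, if st.1 then true :: st.2 else st.2) else st)
   (keep, [::]) R).2.

(* [n <= b + 2 v] iff half of [n], rounded down if [b] and up otherwise, is at
   most [v]. *)
Definition count_le (R k : bits) : bool :=
  ~~ has id (foldl (fun R (b : bool) => halve (~~ b) R) R k).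

(** Tries all choices of [n] deletions, repetitions included, followed by one addition. With [n]
    fixed this is a constant number of nested loops over the vertices. *)
Fixpoint search p (n : nat) (M : label_matrix) (k R : bits) : bool :=
  if n is n'.+1 then has (fun e => search p n' M k (bits_diff R e)) (basis M)
  else has (fun e => count_le (bits_union R e) k && resolves p M (bits_union R e))
    (basis M).

Definition decide p (x : label_matrix * (bool * bits)) : bool :=
  ~~ x.2.1 && search p p.+2 x.1 x.2.2 (low_degree x.1).

(** * Polynomial running time of the algorithm *)

Lemma esize_bits (s : bits) n : size s <= n -> esize s <= n * 4 + 1.
Proof.
move=> le_s; apply: leq_trans (esize_seq (k := 3) (fun b _ => esize_bool b)) _.
by rewrite leq_add2r leq_mul2r le_s orbT.
Qed.

Lemma size_le_ptime (X A : encodable) (f : X -> seq A) (q : {poly nat}) x k :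
  (forall x, esize (f x) <= peval q (esize x)) -> k <= size (f x) ->
  k <= peval q (esize x).
Proof.
move=> size_f le_k; apply: leq_trans le_k _.
exact: leq_trans (ltnW (size_le_esize _)) (size_f x).
Qed.

Lemma ptime_meets (X : encodable) (a b : X -> bits) :
  ptime a -> ptime b -> ptime (fun x => meets (a x) (b x)).
Proof. by move=> pa pb; apply: ptime_has; [ptime_tac | apply: ptime_zip]. Qed.

Lemma ptime_bits_diff (X : encodable) (a b : X -> bits) :
  ptime a -> ptime b -> ptime (fun x => bits_diff (a x) (b x)).
Proof. by move=> pa pb; apply: ptime_map; [ptime_tac | apply: ptime_zip]. Qed.

Lemma ptime_bits_union (X : encodable) (a b : X -> bits) :
  ptime a -> ptime b -> ptime (fun x => bits_union (a x) (b x)).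
Proof. by move=> pa pb; apply: ptime_map; [ptime_tac | apply: ptime_zip]. Qed.

Lemma ptime_low_degree (X : encodable) (M : X -> label_matrix) :
  ptime M -> ptime (fun x => low_degree (M x)).
Proof.
move=> pM; apply: (ptime_map (f := fun _ r => ~~ (foldl _ _ r).2)) => //.
apply: ptime_negb; apply: ptime_snd.
apply: (ptime_foldl (F := fun _ (ab : bool * bool) (x : bits) =>
  if nilp x then ab else (true, ab.1 || ab.2)) (I := fun _ _ _ => True) (b := fun=> 7));
  try by ptime_tac.
- exact: poly_bounded_const.
- by move=> x k [[] []].
Qed.

Lemma ptime_basis (X : encodable) (M : X -> label_matrix) :
  ptime M -> ptime (fun x => basis (M x)).
Proof.
move=> pM; have [q size_M] := ptime_size pM.
apply: (ptime_foldl (F := fun _ (acc : seq bits) (_ : seq bits) =>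
    (true :: map (fun=> false) acc) :: map (cons false) acc)
  (I := fun _ k acc => size acc = k /\ forall e, List.In e acc -> size e = k)
  (b := fun n => peval q n * (peval q n * 4 + 1).+1 + 1)) => //.
- apply: ptime_cons; first (apply: ptime_cons; first exact: ptime_const).
    by apply: (ptime_map (f := fun _ _ => false)); ptime_tac.
  by apply: (ptime_map (f := fun _ e => false :: e)); ptime_tac.
- exact: ptime_const.
- move=> x k acc _ _ [<- sub] _; split=> /=; first by rewrite size_map.
  by move=> e [<- | /List.in_map_iff[e' [<- /sub /= ->]]] //=; rewrite size_map.
- by poly_bounded_tac.
move=> x k acc le_k [acc_k sub].
have le_q : k <= peval q (esize x).
  exact: size_le_ptime size_M le_k.
apply: leq_trans (esize_seq (k := peval q (esize x) * 4 + 1) _) _.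
  by move=> e /sub size_e; apply: esize_bits; rewrite size_e.
by rewrite acc_k leq_add2r leq_mul2r le_q orbT.
Qed.

Lemma ptime_step (X : encodable) lab (M : X -> label_matrix) (cur : X -> bits) :
  ptime M -> ptime cur -> ptime (fun x => step lab (M x) (cur x)).
Proof.
move=> pM pcur.
apply: (ptime_map (f := fun x z => z.2 ||
  has (fun y => y.2 && (y.1 == nat_bits lab)) (zip z.1 (cur x)))); last exact: ptime_zip.
apply: ptime_orb; first by ptime_tac.
apply: (ptime_has (P := fun _ (y : bits * bool) => y.2 && (y.1 == nat_bits lab))).
  by apply: ptime_andb; [|apply: ptime_eq_const]; ptime_tac.
apply: ptime_zip; first by ptime_tac.
by apply: (ptime_comp pcur); ptime_tac.
Qed.

Lemma size_step lab M cur : size (step lab M cur) <= size cur.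
Proof. by rewrite /step size_map size_zip geq_minr. Qed.

Lemma ptime_separates (X : encodable) p (M : X -> label_matrix) (s e e' : X -> bits) :
  ptime M -> ptime s -> ptime e -> ptime e' ->
  ptime (fun x => separates p (M x) (s x) (e x) (e' x)).
Proof.
move=> pM ps pe pe'; have [q size_s] := ptime_size ps.
apply: ptime_snd; apply: (ptime_foldl (F := fun x st _ => foldl (fun st lab =>
    (step lab (M x) st.1, st.2 || ~~ (meets st.1 (e x) == meets st.1 (e' x))))
    st (iota 1 p))
  (I := fun x _ st => size st.1 <= size (s x))
  (b := fun n => (peval q n * 4 + 4).+1)) => //.
- apply: (ptime_foldl_const (F := fun lab (y : X * (bits * bool * seq bits)) st =>
    (step lab (M y.1) st.1,
     st.2 || ~~ (meets st.1 (e y.1) == meets st.1 (e' y.1))))); last by ptime_tac.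
  have lift (A : encodable) (h : X -> A) : ptime h ->
      ptime (fun y : X * (bits * bool * seq bits) * (bits * bool) => h y.1.1).
    by move=> ph; apply: (ptime_comp ph); ptime_tac.
  move=> lab; apply: ptime_pair.
    by apply: ptime_step; [apply: lift | ptime_tac].
  apply: ptime_orb; first by ptime_tac.
  by apply/ptime_negb/ptime_eqb; apply: ptime_meets; (apply: lift || ptime_tac).
- by apply: ptime_pair => //; apply: ptime_const.
- move=> x _ st _ _ le_st _; elim: (iota 1 p) st le_st => //= lab labs IH st le_st.
  by apply: IH; apply: leq_trans (size_step _ _ _) le_st.
- by poly_bounded_tac.
move=> x _ [cur b] _ /= le_cur; rewrite esize_pair ltnS.
have := esize_bits (size_le_ptime size_s le_cur); have := esize_bool b.
lia.
Qed.

Lemma ptime_resolves (X : encodable) p (M : X -> label_matrix) (R : X -> bits) :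
  ptime M -> ptime R -> ptime (fun x => resolves p (M x) (R x)).
Proof.
move=> pM pR.
have pB (Y : encodable) (h : Y -> X) : ptime h -> ptime (fun y => basis (M (h y))).
  by move=> ph; apply/ptime_basis/(ptime_comp pM).
apply: (ptime_all (P := fun x e => all (fun e' => meets e e' ||
  has (fun s => meets s (R x) && separates p (M x) s e e') (basis (M x))) (basis (M x))));
  last exact: ptime_basis.
apply: (ptime_all (P := fun y e' => meets y.2 e' ||
  has (fun s => meets s (R y.1) && separates p (M y.1) s y.2 e') (basis (M y.1))));
  last by apply: pB; ptime_tac.
apply: ptime_orb; first by apply: ptime_meets; ptime_tac.
apply: (ptime_has (P := fun y s => meets s (R y.1.1) &&
  separates p (M y.1.1) s y.1.2 y.2)); last by apply: pB; ptime_tac.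
apply: ptime_andb; first by apply: ptime_meets; [|apply: (ptime_comp pR)]; ptime_tac.
by apply: ptime_separates; first (by apply: (ptime_comp pM); ptime_tac); ptime_tac.
Qed.

Lemma size_halve keep R : size (halve keep R) <= size R.
Proof.
rewrite /halve -[size R]addn0 -[X in _ + X]/(size ([::] : bits)).
elim: R keep [::] => //= x R IHR keep acc.
by case: x; [case: keep|]; apply: leq_trans (IHR _ _) _; rewrite /=; lia.
Qed.

Lemma ptime_halve (X : encodable) (keep : X -> bool) (R : X -> bits) :
  ptime keep -> ptime R -> ptime (fun x => halve (keep x) (R x)).
Proof.
move=> pk pR; have [q size_R] := ptime_size pR.
apply: ptime_snd; apply: (ptime_foldl (F := fun _ (st : bool * bits) (x : bool) =>
    if x then (~~ st.1, if st.1 then true :: st.2 else st.2) else st)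
  (I := fun _ k st => size st.2 <= k) (b := fun n => (peval q n * 4 + 4).+1)) => //.
- by ptime_tac.
- by ptime_tac.
- move=> x k [b s] y _ /= le_s _; case: y => /=; last exact: leqW.
  by case: b => //=; apply: leqW.
- by poly_bounded_tac.
move=> x k [b s] le_k /= le_s; rewrite esize_pair.
have := esize_bits (size_le_ptime size_R (leq_trans le_s le_k)).
have := esize_bool b; lia.
Qed.

Lemma ptime_count_le (X : encodable) (R k : X -> bits) :
  ptime R -> ptime k -> ptime (fun x => count_le (R x) (k x)).
Proof.
move=> pR pk; have [q size_R] := ptime_size pR.
apply: ptime_negb; apply: (ptime_has (P := fun _ b => b)); first by ptime_tac.
apply: (ptime_foldl (F := fun _ R (b : bool) => halve (~~ b) R)
  (I := fun x _ R' => size R' <= size (R x)) (b := fun n => peval q n * 4 + 1)) => //.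
- by apply: ptime_halve; ptime_tac.
- by move=> x _ R' b _ le_R' _; apply: leq_trans (size_halve _ _) le_R'.
- by poly_bounded_tac.
by move=> x _ R' _ le_R'; apply: esize_bits (size_le_ptime size_R le_R').
Qed.

(** The induction varies the context type [X], since each nested loop adds its vertex to the data
    available to the inner one. *)
Lemma ptime_search p n (X : encodable) (M : X -> label_matrix) (k R : X -> bits) :
  ptime M -> ptime k -> ptime R -> ptime (fun x => search p n (M x) (k x) (R x)).
Proof.
elim: n X M k R => [|n IHn] X M k R pM pk pR.
  apply: (ptime_has (P := fun x e => count_le (bits_union (R x) e) (k x) &&
    resolves p (M x) (bits_union (R x) e))); last exact: ptime_basis.
  have pA : ptime (fun y : X * bits => bits_union (R y.1) y.2).
    by apply: ptime_bits_union; [apply: (ptime_comp pR)|]; ptime_tac.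
  apply: ptime_andb; first by apply: ptime_count_le; [|apply: (ptime_comp pk); ptime_tac].
  by apply: ptime_resolves; [apply: (ptime_comp pM); ptime_tac|].
apply: (ptime_has (P := fun x e => search p n (M x) (k x) (bits_diff (R x) e)));
  last exact: ptime_basis.
apply: IHn; [apply: (ptime_comp pM)|apply: (ptime_comp pk)|apply: ptime_bits_diff];
  try by ptime_tac.
by apply: (ptime_comp pR); ptime_tac.
Qed.

Lemma ptime_decide p : ptime (decide p).
Proof.
apply: ptime_andb; first by ptime_tac.
apply: (@ptime_search p p.+2 _ (fun x : label_matrix * (bool * bits) => x.1)
  (fun x => x.2.2)); try by ptime_tac.
by apply: ptime_low_degree; ptime_tac.
Qed.

(** * Correctness of the algorithm *)

Definition bits_value (k : bits) : nat := foldr (fun (b : bool) v => b + v.*2) 0 k.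

Lemma nat_bitsK : cancel nat_bits bits_value.
Proof.
have pos_bitsK q : bits_value (pos_bits q) = nat_of_pos q.
  by elim: q => //= q ->; rewrite natTrecE.
move=> n; rewrite -{2}(bin_of_natK n) /nat_bits.
by case: (bin_of_nat n).
Qed.

Lemma nilp_nat_bits n : nilp (nat_bits n) = (n == 0).
Proof.
by rewrite -(inj_eq (can_inj nat_bitsK)); case: (nat_bits n).
Qed.

Lemma count_halve keep R :
  count id (halve keep R) = if keep then uphalf (count id R) else (count id R)./2.
Proof.
rewrite /halve -[RHS]addn0 -[X in _ + X]/(count id [::]).
elim: R keep [::] => [|[] R IHR] keep acc /=; first by case: keep.
  by rewrite IHR; case: keep => /=; lia.
by rewrite IHR add0n.
Qed.

Lemma count_leE R k : count_le R k = (count id R <= bits_value k).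
Proof.
rewrite /count_le; elim: k R => [|b k IHk] R /=; first by rewrite has_count -leqNgt.
by rewrite IHk count_halve; case: b => /=; lia.
Qed.

Lemma basisE M :
  basis M = [seq [seq i == j | j <- iota 0 (size M)] | i <- iota 0 (size M)].
Proof.
pose U n := [seq [seq i == j | j <- iota 0 n] | i <- iota 0 n].
rewrite /basis; set F := fun _ _ => _.
(* Generalised to a fold that starts from the unit vectors of dimension [n]. *)
suff gen n : foldl F (U n) M = U (n + size M) by exact: (gen 0).
elim: M n => [|r M IHM] n /=; first by rewrite addn0.
rewrite addnS -addSn -IHM; congr foldl; rewrite /F /U /=.
rewrite -map_comp (iotaDl 1 0) -!map_comp; congr (_ :: _).
by apply: eq_map => i /=; rewrite -map_comp.
Qed.

(** * The algorithm on characteristic vectors of vertex sets *)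

Section Correctness.
Variables (p : nat) (p_gt0 : 0 < p) (P : periodic_tgraph p).
Local Notation V := 'I_(nvertices P).
Local Notation G := (tgraph_of P).

Definition adjacency : label_matrix :=
  [seq [seq nat_bits (if pgraph P u v then label P u v else 0) | v <- enum V]
      | u <- enum V].

Definition charvec (A : pred V) : bits := map A (enum V).

Lemma eq_charvec (A B : pred V) : A =1 B -> charvec A = charvec B.
Proof. by move=> eqAB; apply: eq_map. Qed.

Lemma has_enum (A : pred V) : has A (enum V) = [exists v, A v].
Proof. by apply/hasP/existsP => -[v]; exists v; rewrite ?mem_enum. Qed.

Lemma all_enum (A : pred V) : all A (enum V) = [forall v, A v].
Proof.
by apply/allP/forallP => A_all v; [|move=> _]; apply: A_all; rewrite ?mem_enum.
Qed.

Lemma meets_charvec (A B : pred V) :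
  meets (charvec A) (charvec B) = [exists v, A v && B v].
Proof. by rewrite /meets /charvec zip_map has_map -has_enum. Qed.

Lemma meets_pred1 (A : pred V) v : meets (charvec A) (charvec (pred1 v)) = A v.
Proof.
rewrite meets_charvec; apply/existsP/idP => [[x /andP[Ax /eqP <-]] //|Av].
by exists v; rewrite Av /=.
Qed.

Lemma bits_diff_charvec (A : pred V) v :
  bits_diff (charvec A) (charvec (pred1 v)) = charvec (fun x => A x && (x != v)).
Proof. by rewrite /bits_diff /charvec zip_map -map_comp. Qed.

Lemma bits_union_charvec (A : pred V) v :
  bits_union (charvec A) (charvec (pred1 v)) = charvec (fun x => A x || (x == v)).
Proof. by rewrite /bits_union /charvec zip_map -map_comp. Qed.

Lemma count_enum (A : pred V) : count A (enum V) = #|A|.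
Proof.
rewrite cardE -size_filter /enum_mem -filter_predI; congr size.
by apply: eq_filter => v; rewrite /= andbT.
Qed.

Lemma count_charvec (A : pred V) : count id (charvec A) = #|A|.
Proof. by rewrite /charvec count_map -count_enum; apply: eq_count. Qed.

Lemma basis_adjacency : basis adjacency = [seq charvec (pred1 v) | v <- enum V].
Proof.
rewrite basisE size_map size_enum_ord -val_enum_ord -map_comp.
apply: eq_map => v /=; rewrite /charvec -map_comp.
by apply: eq_map => u /=; rewrite eq_sym.
Qed.

Lemma low_degree_adjacency :
  low_degree adjacency = charvec (fun v => #|pgraph P v| <= 1).
Proof.
rewrite /low_degree /adjacency -map_comp; apply: eq_map => v /=.
have -> (r : seq bits) : (foldl (fun (ab : bool * bool) x =>
    if nilp x then ab else (true, ab.1 || ab.2)) (false, false) r).2 =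
    (1 < count (fun x => ~~ nilp x) r).
  suff gen a b : (foldl (fun (ab : bool * bool) x =>
      if nilp x then ab else (true, ab.1 || ab.2)) (a, b) r).2 =
      b || (1 < a + count (fun x => ~~ nilp x) r) by rewrite gen.
  elim: r a b => [|x r IHr] a b /=; first by case: a; case: b.
  case: (nilp x) => /=; first by rewrite IHr.
  by rewrite IHr; case: a; case: b => //=; rewrite !add0n; lia.
rewrite -leqNgt count_map -count_enum; congr (_ <= 1); apply: eq_count => u /=.
rewrite nilp_nat_bits.
by case: ifP => // /label_range/andP[lab_gt0 _]; rewrite -lt0n.
Qed.

(** Two numbers between 1 and [p] that are congruent modulo [p] are equal, so comparing labels with
    [i] decides which edges are present at time [t.+1]. *)
Lemma step_adjacency s t i : 0 < i <= p -> t.+1 = i %[mod p] ->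
  step i adjacency (charvec [in reach G s t]) = charvec [in reach G s t.+1].
Proof.
move=> /andP[i_gt0 le_ip] eq_t.
rewrite /step /charvec /adjacency zip_map -map_comp; apply: eq_map => v /=.
rewrite zip_map has_map has_enum inE; congr (_ || _).
rewrite inE; apply: eq_existsb => u /=; congr (_ && _).
rewrite (inj_eq (can_inj nat_bitsK)) adj_sym label_sym.
(* Non-edges carry 0, which differs from the positive [i]. *)
case: ifP => [adj_uv|_]; last by rewrite /=; lia.
have /andP[lab_gt0 le_lab] := label_range adj_uv.
rewrite [RHS](@progression_next p p_gt0 t) ?lab_gt0 // eq_t eq_sym.
apply/eqP/eqP => [-> //|].
move: le_lab le_ip; rewrite (leq_eqVlt (label P u v)) (leq_eqVlt i).
move=> /orP[/eqP->|lt_lab] /orP[/eqP->|lt_i] //.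
- by rewrite modnn modn_small //; lia.
- by rewrite modnn modn_small //; lia.
- by rewrite !modn_small.
Qed.

Section Trace.
Variables s u v : V.

(** The state of the simulation after [t] time-steps; the flag covers the times strictly below
    [t]. *)
Let trace t : bits * bool := (charvec [in reach G s t],
  has (fun t' => (u \in reach G s t') != (v \in reach G s t')) (iota 0 t)).

Lemma separatesE : separates p adjacency (charvec (pred1 s)) (charvec (pred1 u))
    (charvec (pred1 v)) = (trace (nvertices P * p)).2.
Proof.
pose F (st : bits * bool) lab := (step lab adjacency st.1,
  st.2 || ~~ (meets st.1 (charvec (pred1 u)) == meets st.1 (charvec (pred1 v)))).
rewrite /separates.
rewrite -[foldl _ _ _]/(foldl (fun st _ => foldl F st (iota 1 p)) (_, false) adjacency).
have traceS t i : 0 < i <= p -> t.+1 = i %[mod p] -> F (trace t) i = trace t.+1.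
  move=> i_range eq_t; rewrite /F /= step_adjacency // !meets_pred1 /trace.
  by rewrite -addn1 iotaD has_cat /= orbF.
(* Within round [k], label [t] is processed at time [k * p + t]; the second alternative confines the
   induction to [t <= p]. *)
have period t k : foldl F (trace (k * p)) (iota 1 t) = trace (k * p + t) \/ p < t.
  elim: t => [|t IHt]; first by left; rewrite addn0.
  have [lt_pt|le_tp] := ltnP p t.+1; [by right | left].
  case: IHt => [IHt|]; last by lia.
  rewrite -[t.+1]addn1 iotaD foldl_cat IHt /= add1n traceS //.
    by rewrite addn1 addnS.
  by rewrite -addnS modnMDl.
have -> : (charvec (pred1 s), false) = trace (0 * p).
  by rewrite /trace /=; congr (_, _); apply: eq_charvec => x; rewrite !inE.
have -> : nvertices P = size adjacency by rewrite size_map size_enum_ord.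
congr snd; suff gen M k : foldl (fun st (_ : seq bits) => foldl F st (iota 1 p))
  (trace (k * p)) M = trace ((k + size M) * p) by exact: (gen _ 0).
elim: M k => [|r M IHM] k; first by rewrite addn0.
rewrite -[size _]/(size M).+1 -addSnnS -IHM.
rewrite -[LHS]/(foldl _ (foldl F (trace (k * p)) (iota 1 p)) M).
by case: (period p k) => [->|]; rewrite ?ltnn // mulSn addnC.
Qed.

End Trace.

Hypothesis conn : forall u v, connect (pgraph P) u v.

Lemma separates_dist (s u v : V) : separates p adjacency (charvec (pred1 s))
  (charvec (pred1 u)) (charvec (pred1 v)) = (dist G s u != dist G s v).
Proof.
rewrite separatesE /=; apply/hasP/idP => [[t _]|neq_d].
  by rewrite !(reach_distE p_gt0 conn); apply: contraNneq => ->.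
wlog lt_uv : u v neq_d / dist G s u < dist G s v.
  move=> sym; have := neq_d; rewrite neq_ltn => /orP[] /sym; first exact.
  by rewrite eq_sym => /(_ neq_d)[t t_lt neq]; exists t; rewrite // eq_sym.
(* The smaller distance is a time when only one target has been reached. It lies below the larger
   one, which is at most [p] times the number of vertices minus one, hence within the simulated
   range. *)
exists (dist G s u); last by rewrite !(reach_distE p_gt0 conn) leqnn leqNgt lt_uv.
rewrite mem_iota /= add0n mulnC; have := dist_le p_gt0 conn s v.
have n_gt0 : 0 < nvertices P := leq_trans (ltn0Sn _) (ltn_ord s).
move=> le_d; apply: leq_trans lt_uv (leq_trans le_d _).
by rewrite leq_mul2l leq_pred orbT.
Qed.

Lemma resolvesE (A : pred V) : resolves p adjacency (charvec A) =
  [forall u, forall v, (u == v) || [exists s, A s && (dist G s u != dist G s v)]].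
Proof.
rewrite /resolves basis_adjacency all_map all_enum; apply: eq_forallb => u /=.
rewrite all_map all_enum; apply: eq_forallb => v /=.
rewrite meets_pred1 /= eq_sym has_map has_enum; congr (_ || _).
apply: eq_existsb => s /=; rewrite separates_dist; congr (_ && _).
rewrite meets_charvec; apply/existsP/idP => [[x /andP[/eqP-> //]]|As].
by exists s; rewrite /= eqxx.
Qed.

Lemma searchP n k (A : pred V) : reflect
  (exists (a : seq V) (w : V), size a = n /\
    let R := fun v => (v == w) || (A v && (v \notin a)) in
    count_le (charvec R) k && resolves p adjacency (charvec R))
  (search p n adjacency k (charvec A)).
Proof.
elim: n A => [|n IHn] A /=; rewrite basis_adjacency has_map.
  apply: (iffP hasP) => [[w _ /=]|[a [w [/size0nil -> /= ok]]]].
    rewrite bits_union_charvec => ok; exists [::], w; split=> //=.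
    by congr (_ && _): ok; congr (_ _ _); apply: eq_charvec => v; rewrite /= andbT orbC.
  exists w; rewrite ?mem_enum //= bits_union_charvec; move: ok.
  by congr (_ && _); congr (_ _ _); apply: eq_charvec => v; rewrite /= andbT orbC.
apply: (iffP hasP) => [[e _ /=]|[[|e a] [w [//= [size_a] ok]]]].
  rewrite bits_diff_charvec => /IHn[a [w [size_a ok]]]; exists (e :: a), w.
  split; first by rewrite /= size_a.
  rewrite /= (@eq_charvec _ (fun v => (v == w) || (A v && (v != e) && (v \notin a)))) //.
  by move=> v; rewrite inE negb_or andbA.
exists e; rewrite ?mem_enum //= bits_diff_charvec; apply/IHn; exists a, w; split=> //=.
rewrite (@eq_charvec _ (fun v => (v == w) || (A v && (v \notin e :: a)))) //.
by move=> v; rewrite inE negb_or andbA.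
Qed.

End Correctness.

(** * From instances to the decision procedure *)

Lemma encode_instance p (x : instance p) :
  enc_instance x = encode (adjacency x.1, ((x.2 < 0)%R, nat_bits `|x.2|%N)).
Proof.
have enc_map (A B : Type) (enc : B -> tree) (h : A -> B) s :
  enc_seq enc (map h s) = enc_seq (fun a => enc (h a)) s by rewrite /enc_seq foldr_map.
rewrite /enc_instance /enc_tgraph /encode /= /adjacency enc_map; congr Node.
by congr (enc_seq _ _); apply: boolp.funext => u; rewrite enc_map.
Qed.

(** An accepted set contains [w], so it is nonempty and resolving. Conversely [small_resolving]
    replaces any solution by one that the search visits, of no larger size. *)
Lemma decideP p (x : instance p) : 0 < p -> subdivided_star (pgraph x.1) ->
  decide p (adjacency x.1, ((x.2 < 0)%R, nat_bits `|x.2|%N)) <->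
  temporal_resolving_set x.
Proof.
case: x => P k /= p_gt0 [m [l [f [[g fK gK] adjE]]]].
have conn := star_connected fK gK adjE.
have n_gt0 : 0 < nvertices P := leq_trans (ltn0Sn _) (ltn_ord (g None)).
rewrite -[decide p _]/(~~ (k < 0)%R &&
  search p p.+2 (adjacency P) (nat_bits `|k|%N) (low_degree (adjacency P))).
rewrite low_degree_adjacency /temporal_resolving_set [_.1]/= [_.2]/=.
have resolving_iff (R : {set 'I_(nvertices P)}) :
    temporal_resolving (tgraph_of P) R <->
    R != set0 /\ resolves p (adjacency P) (charvec [in R]).
  rewrite (resolvingE p_gt0 conn) // resolvesE //; split=> -[-> sep]; split=> //.
    apply/forallP=> u; apply/forallP=> v; case: eqVneq => //= /sep[s Rs neq].
    by apply/existsP; exists s; rewrite /= Rs.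
  move=> u v /negbTE neq_uv; have /forallP/(_ u)/forallP/(_ v) := sep.
  by rewrite neq_uv => /existsP[s /andP[Rs neq]]; exists s.
split=> [/andP[k_ge0 /searchP[a [w [_ /andP[]]]]]|[R resR le_Rk]].
  set A := fun v => _ || _; rewrite count_leE nat_bitsK count_charvec => le_k res.
  exists [set v | A v]; last first.
    have <- : (`|k|%N : int) = k by lia.
    by rewrite lez_nat cardsE.
  apply/resolving_iff; split; first by apply/set0Pn; exists w; rewrite inE /A eqxx.
  by rewrite (@eq_charvec _ _ _ A) // => v; rewrite inE.
have [a [w [size_a [resR' le_R']]]] := small_resolving p_gt0 fK gK adjE resR.
apply/andP; split; first by lia.
apply/searchP; exists a, w; split=> //=.
move: resR' le_R'; set R' := [set v | _] => /resolving_iff[_ res] le_R'.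
rewrite (@eq_charvec _ _ _ [in R']) => [|v]; last by rewrite inE.
have le_k : #|R| <= `|k|%N by lia.
rewrite res andbT count_leE nat_bitsK count_charvec.
exact: leq_trans le_R' le_k.
Qed.

Theorem theorem15 (p : nat) (p_ge1 : 1 <= p) :
  polynomial_time (@enc_instance p)
    (fun x : instance p => subdivided_star (pgraph x.1))
    (@temporal_resolving_set p).
Proof.
have [q [_ comp_decide]] := ptime_decide p.
have [c comp_c] := comp_decide 0; exists c, q => x star_x.
pose input := (adjacency x.1, ((x.2 < 0)%R, nat_bits `|x.2|%N)).
have enc_x : enc_instance x = encode input := encode_instance x.
have [s [t [ex_c s_out _ le_t]]] :=
  comp_c (fun y => if y == 0 then enc_instance x else Leaf) input enc_x.
exists (encode (decide p input)), t; split.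
- by exists s.
- by rewrite enc_x.
- by rewrite -decideP //; case: (decide p input).
Qed.
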